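(* Let $\eta\in[0,1/3)$ and $\alpha>0$. Consider any polynomial-time estimator which uses $n\le o(d\eta^2/\alpha^4)$ samples from $\mathcal N(\mu,\mathrm{Id}_d)$ to perform $\eta$-robust empirical mean estimation to error $\alpha$. If any such estimator succeeds (outputs an estimate within $\ell_2$ distance $\alpha$ of the empirical mean of the uncorrupted samples) with probability at least $\frac23$ for every $\mu$ with $\|\mu\|_2\le21\alpha$ and every $\eta$-corruption, then there is a polynomial-time algorithm for the $(\eta,\Theta(\alpha/\eta))$-Gaussian mixtures distinguishing problem.
   Context: Strong contamination model: $n$ samples are drawn i.i.d.; an adversary who sees them may replace any $\eta n$ of them arbitrarily. $\eta$-robust empirical mean estimation: from the corrupted data, estimate the empirical mean of the original uncorrupted samples. The $(\eta,\delta)$-Gaussian mixtures distinguishing problem (given $n$ samples in $\mathbb{R}^d$): distinguish, with constant advantage, the null distribution under which samples are i.i.d. $\mathcal N(0,\mathrm{Id}_d)$ from the planted distribution under which a unit vector $v$ is drawn uniformly from $\mathbb S^{d-1}$ and then samples are i.i.d. from $(1-\eta)\mathcal N(-\eta\delta v,\mathrm{Id}_d)+\eta\mathcal N((1-\eta)\delta v,\mathrm{Id}_d)$.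
   Formalization: It is additionally assumed that ηn ≥ 1 for all large d (hence η > 0), so that at least one sample may be corrupted; otherwise the sample mean is an exact estimator and the claim fails, e.g. η = 1/4, n = 3, α = 1. *)

(* Defs.v *)
From HB Require Import structures.
From mathcomp Require Import all_boot all_order all_algebra.
From mathcomp Require Import all_classical all_reals all_analysis.

Set Implicit Arguments.
Unset Strict Implicit.
Unset Printing Implicit Defensive.

Import Order.TTheory GRing.Theory Num.Theory.
Import numFieldNormedType.Exports.

Local Open Scope classical_set_scope.
Local Open Scope ring_scope.

Notation vect R d := (d.-tuple (measurableTypeR R)).
Notation samples R n d := (n.-tuple (vect R d)).

Section vectors.
Context (R : realType).

Definition enorm d (x : vect R d) : R := Num.sqrt (\sum_(i < d) tnth x i ^+ 2).

Definition edist d (x y : vect R d) : R :=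
  enorm [tuple tnth x i - tnth y i | i < d].

Definition vscale d (a : R) (x : vect R d) : vect R d :=
  [tuple a * tnth x i | i < d].

Definition mxapply d (Q : 'M[R]_d) (x : vect R d) : vect R d :=
  [tuple \sum_(j < d) Q i j * tnth x j | i < d].

Definition emp_mean n d (X : samples R n d) : vect R d :=
  [tuple (n%:R)^-1 * \sum_(i < n) tnth (tnth X i) j | j < d].

Definition hamming n d (X Y : samples R n d) : nat :=
  #|[set i | tnth X i != tnth Y i]%SET|.

End vectors.

Section product_laws.
Context dsp (T : measurableType dsp) (R : realType).

Definition pcons n (z : T * n.-tuple T) : n.+1.-tuple T :=
  [tuple of z.1 :: z.2].

Lemma measurable_pcons n : measurable_fun [set: T * n.-tuple T] (@pcons n).
Proof. exact: measurable_cons. Qed.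

HB.instance Definition _ n :=
  isMeasurableFun.Build _ _ _ _ (@pcons n) (@measurable_pcons n).

(* The law of n independent variables, the i-th one having law P i. *)
Fixpoint prod_law (P : nat -> probability T R) (n : nat) :
    probability (n.-tuple T) R :=
  match n with
  | O => dirac [tuple]
  | S m => distribution
      ((P O \x prod_law (fun i => P i.+1) m)%E : probability _ R) (@pcons m)
  end.

Definition iid_law (P : probability T R) n := prod_law (fun=> P) n.

End product_laws.

(* (1 - p) P + p Q; as for bernoulli_prob, the value for p outside [0, 1] is
   an arbitrary probability measure. *)
Definition mixture dsp (T : measurableType dsp) (R : realType) (p : R)
    (P Q : probability T R) (A : set T) : \bar R :=
  if 0 <= p <= 1 then ((1 - p)%:E * P A + p%:E * Q A)%E else P A.

Section mixture_probability.
Context dsp (T : measurableType dsp) (R : realType) (p : R).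
Context (P Q : probability T R).
Local Open Scope ereal_scope.

Let mixture0 : mixture p P Q set0 = 0.
Proof. by rewrite /mixture !measure0 !mule0 adde0 if_same. Qed.

Let mixture_ge0 A : 0 <= mixture p P Q A.
Proof.
rewrite /mixture; case: ifPn => [/andP[p0 p1]|_]; last exact: measure_ge0.
by rewrite adde_ge0// mule_ge0// lee_fin// subr_ge0.
Qed.

Let mixture_sigma_additive : semi_sigma_additive (mixture p P Q).
Proof.
have [p01|p01] := boolP (0 <= p <= 1)%R; last first.
  rewrite (_ : mixture p P Q = P); first exact: measure_semi_sigma_additive.
  by apply/funext => A; rewrite /mixture (negbTE p01).
have /andP[p0 p1] := p01.
have q0 : (0 <= 1 - p)%R by rewrite subr_ge0.
rewrite (_ : mixture p P Q =
    measure_add (mscale (NngNum q0) P) (mscale (NngNum p0) Q)).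
  exact: measure_semi_sigma_additive.
by apply/funext => A; rewrite /mixture p01 measure_addE.
Qed.

HB.instance Definition _ := isMeasure.Build _ _ _ (mixture p P Q)
  mixture0 mixture_ge0 mixture_sigma_additive.

Let mixture_setT : mixture p P Q [set: T] = 1.
Proof.
by rewrite /mixture !probability_setT !mule1 -EFinD subrK if_same.
Qed.

HB.instance Definition _ :=
  Measure_isProbability.Build _ _ _ (mixture p P Q) mixture_setT.

End mixture_probability.

Section sample_laws.
Context (R : realType).

(* N(mu, Id_d): independent coordinates N(mu_j, 1). *)
Definition gauss d (mu : vect R d) : probability (vect R d) R :=
  prod_law (fun j => normal_prob (nth 0 mu j) 1 : probability _ R) d.

Definition gauss_mixture d (eta delta : R) (v : vect R d) :
    probability (vect R d) R :=
  mixture eta (gauss (vscale (- (eta * delta)) v))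
              (gauss (vscale ((1 - eta) * delta) v)).

(* The uniform law on the unit sphere is the rotation-invariant one. *)
Definition uniform_sphere d (sigma : probability (vect R d) R) : Prop :=
  sigma [set v | enorm v = 1] = 1%E /\
  forall Q : 'M[R]_d, Q *m Q^T = 1%:M ->
  forall A, measurable A -> sigma (mxapply Q @^-1` A) = sigma A.

End sample_laws.

(** * Randomized real-RAM programs

   Registers hold natural numbers (used as counters and indices), arrays hold
   real numbers; both are named by natural numbers, and array cells are
   addressed through registers: a pair a, x of operands denotes the cell of
   array a whose index is in register x. Field operations and comparisons on reals have
   unit cost, and [RGauss] draws a fresh N(0, 1) variable. Register
   arithmetic is limited to adding and subtracting one, so that unit cost is
   also reasonable for registers. *)

Inductive rop := Radd | Rsub | Rmul | Rdiv.

Inductive test :=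
| TLt (x y : nat)
| TRle (a x b y : nat).

Inductive cmd :=
| IConst (x k : nat)
| ICopy (x y : nat)
| ISucc (x : nat)
| IPred (x : nat)
| RConst (a x : nat) (z : int)
| RCopy (a x b y : nat)
| ROp (o : rop) (a x b y c z : nat)
| RGauss (a x : nat)
| Seq (p q : cmd)
| If (t : test) (p q : cmd)
| While (t : test) (p : cmd).

Section semantics.
Context (R : realType).

Record store := Store {
  reg : nat -> nat;
  arr : nat -> nat -> R;
  tape : nat -> R }.

Definition upd (T : Type) (f : nat -> T) (x : nat) (v : T) : nat -> T :=
  fun y => if y == x then v else f y.

Definition set_reg s x k := Store (upd (reg s) x k) (arr s) (tape s).

Definition get_arr s a x := arr s a (reg s x).

Definition set_arr s a x r :=
  Store (reg s) (upd (arr s) a (upd (arr s a) (reg s x) r)) (tape s).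

Definition rop_eval (o : rop) : R -> R -> R :=
  match o with
  | Radd => fun u v => u + v
  | Rsub => fun u v => u - v
  | Rmul => fun u v => u * v
  | Rdiv => fun u v => u / v
  end.

Definition test_eval (t : test) s : bool :=
  match t with
  | TLt x y => (reg s x < reg s y)%N
  | TRle a x b y => get_arr s a x <= get_arr s b y
  end.

(* A configuration is the list of commands still to be executed with the
   current store; the running time is the number of steps before that list is
   empty. *)
Definition config : Type := seq cmd * store.

Definition step (c : config) : config :=
  let: (l, s) := c in
  if l is p :: l' then
    match p with
    | IConst x k => (l', set_reg s x k)
    | ICopy x y => (l', set_reg s x (reg s y))
    | ISucc x => (l', set_reg s x (reg s x).+1)
    | IPred x => (l', set_reg s x (reg s x).-1)
    | RConst a x z => (l', set_arr s a x z%:~R)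
    | RCopy a x b y => (l', set_arr s a x (get_arr s b y))
    | ROp o a x b y c z =>
        (l', set_arr s a x (rop_eval o (get_arr s b y) (get_arr s c z)))
    | RGauss a x =>
        let s' := set_arr s a x (tape s 0%N) in
        (l', Store (reg s') (arr s') (fun i => tape s i.+1))
    | Seq q r => ([:: q, r & l'], s)
    | If t q r => ((if test_eval t s then q else r) :: l', s)
    | While t q => (if test_eval t s then [:: q, p & l'] else l', s)
    end
  else c.

Definition run (p : cmd) (T : nat) (s : store) : config :=
  iter T step ([:: p], s).

(* Registers 0 and 1 hold n and d; array 0 holds the two real parameters and
   array 1 the samples, in row-major order; all the rest is zero. *)
Definition init n d (a b : R) (X : samples R n d) (u : nat -> R) : store :=
  Store (nth 0%N [:: n; d])
    (fun i => nth 0 (nth [::] [:: [:: a; b]; flatten (map val X)] i)) u.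

Definition time_bound (k n d : nat) : nat := ((n + d + 2) ^ k)%N.

(* p halts, on every input and for all random choices, within a time which is
   polynomial in n and d. *)
Definition runs_within (p : cmd) (k : nat) : Prop :=
  forall n d (a b : R) (X : samples R n d) (u : nat -> R),
    (run p (time_bound k n d) (init a b X u)).1 = [::].

(* The output is read in array 2. Since a program running for time T reads at
   most T random numbers, a tape of length T is enough. *)
Definition output (p : cmd) (k : nat) n d (a b : R) (X : samples R n d)
    (u : (time_bound k n d).-tuple (measurableTypeR R)) : nat -> R :=
  arr (run p (time_bound k n d) (init a b X (nth 0 u))).2 2.
Arguments output : clear implicits.

Definition estimate p k n d a b (X : samples R n d)
    (u : (time_bound k n d).-tuple (measurableTypeR R)) : vect R d :=
  [tuple output p k n d a b X u j | j < d].
Arguments estimate : clear implicits.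

Definition accepts p k n d a b (X : samples R n d)
    (u : (time_bound k n d).-tuple (measurableTypeR R)) : Prop :=
  0 < output p k n d a b X u 0.
Arguments accepts : clear implicits.

Definition tape_law T : probability (T.-tuple (measurableTypeR R)) R :=
  iid_law (normal_prob 0 1 : probability _ R) T.

(* Strong contamination: an adversary is any coupling (X, Y) of n clean
   samples X with a corrupted data set Y differing from X in at most eta n
   places; only the coins of the estimator are independent of it. *)
Definition robustly_estimates (p : cmd) (k n d : nat) (eta alpha : R)
    (mu : vect R d) : Prop :=
  forall dsp (Omega : measurableType dsp) (P : probability Omega R)
    (X Y : {RV P >-> samples R n d}),
    (forall A, measurable A -> distribution P X A = iid_law (gauss mu) n A) ->
    (forall w, (hamming (X w) (Y w))%:R <= eta * n%:R) ->
    ((2 / 3)%:E <= (P \x tape_law (time_bound k n d))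
      [set z | edist (estimate p k n d eta alpha (Y z.1) z.2)
                     (emp_mean (X z.1)) <= alpha]%R)%E.

Section distinguishing.
Variables (p : cmd) (k n d : nat) (eta delta : R).

Definition accepted :
    set (samples R n d * (time_bound k n d).-tuple (measurableTypeR R)) :=
  [set z | accepts p k n d eta delta z.1 z.2].

Definition null_accept : \bar R :=
  ((iid_law (gauss [tuple (0 : R)%R | _ < d]) n \x
    tape_law (time_bound k n d)) accepted)%E.

Definition planted_accept (sigma : probability (vect R d) R) : \bar R :=
  (\int[sigma]_v (iid_law (gauss_mixture eta delta v) n \x
    tape_law (time_bound k n d)) accepted)%E.

(* Accepting means answering "planted"; the advantage is at least c. *)
Definition distinguishes (c : R) : Prop :=
  forall sigma : probability (vect R d) R, uniform_sphere sigma ->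
    (c%:E + null_accept <= planted_accept sigma)%E.

End distinguishing.

End semantics.

(* Main.v *)
(* Under the null law the estimator A is close to the empirical mean of its own
   input Z. Under the planted law with labels L, the samples labelled 1 are an
   admissible corruption of N(-eta delta v, Id) as soon as |L| <= eta n, and the
   empirical means of the corrupted and clean samples differ by
   |L| delta / n > 2 alpha when |L| >= eta n / 10; so A must be far from the
   empirical mean of Z. The test "A(Z) is far from the mean of Z" thus accepts
   with probability at most 1/3 under the null law, and at least 2/3 under the
   planted law conditioned on good labels.

   Good labels only have probability c0 = 2^-30 in the worst case, so the test
   is first amplified without new data: for independent noise G ~ N(0, Id) and a
   rotation (a, b), the data sets aZ - bG and bZ + aG are independent Gaussians
   whose means are those of Z multiplied by a and b. Iterating five times gives
   32 independent tests, all of which must accept; the acceptance probabilities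
   become at most 3^-32 and at least c0 (2/3)^32 = 4 * 3^-32. The rotation
   (119/169, 120/169) is rational, and balanced enough for all 32 means to keep
   norm at most 21 alpha. *)

Require Import Defs.
From HB Require Import structures.
From mathcomp Require Import all_boot all_order all_algebra.
From mathcomp Require Import all_classical all_reals all_analysis.
From mathcomp Require Import measurable_realfun zify ring lra.

Set Implicit Arguments.
Unset Strict Implicit.
Unset Printing Implicit Defensive.

Import Order.TTheory GRing.Theory Num.Theory.
Import numFieldNormedType.Exports.

Local Open Scope classical_set_scope.
Local Open Scope ring_scope.

(** * The rotation invariance of the Gaussian law *)

(** All clones share the labels, so their factor 2^-30 is paid once, while the gap 2/3 against 1/3
    is raised to the power 32, the first power of two above 30: hence five rounds. Each round
    multiplies the means by cos or sin, and the separation constant has to leave room for this: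
    after five rounds every clone needs a clean mean of norm at most 21 alpha, where the estimator
    is guaranteed to work, and more than 20 alpha, so that a tenth of the corruption budget moves
    the empirical mean by more than 2 alpha. This is the inequality (119/120)^5 > 20/21. The
    distinguisher must be an actual program with a time bound, so rotation, noise and both runs are
    carried out by code, and acceptance probabilities are iterated integrals: [Eg] over the data,
    [V] over the steps of a run. *)

Section normal_law.
Context (R : realType).
Local Open Scope ereal_scope.
Local Notation leb := (@lebesgue_measure R).
Local Notation RR := (measurableTypeR R).

(* Locked: unification must not unfold it to an integral against [leb]. *)
Definition gaussR : R -> probability RR R :=
  locked (fun m : R => normal_prob m 1 : probability RR R).

Lemma gaussRE (m : R) : gaussR m = normal_prob m 1.
Proof. by rewrite /gaussR -lock. Qed.

(** The Radon-Nikodym derivative of the normal law and [normal_pdf] have the same integral over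
    every measurable set, so they agree almost everywhere. *)
Lemma ge0_integral_gaussR m (f : RR -> \bar R) :
  measurable_fun setT f -> (forall x, 0 <= f x) ->
  \int[gaussR m]_x f x = \int[leb]_x (f x * (normal_pdf m 1 x)%:E).
Proof.
move=> mf f0; have dom := normal_prob_dominates m 1; rewrite gaussRE.
rewrite -(@Radon_Nikodym_SigmaFinite.change_of_variables _ _ R
  (normal_prob m 1) leb dom f setT f0 measurableT mf).
have mpdf : measurable_fun setT (fun x : RR => (normal_pdf m 1 x)%:E).
  by apply/measurable_EFinP; exact: measurable_normal_pdf.
have iRN := Radon_Nikodym_SigmaFinite.f_integrable dom.
have mRN := measurable_int _ iRN.
apply: ae_eq_integral => //.
- exact: emeasurable_funM.
- exact: emeasurable_funM.
apply: ae_eqe_mul2l; apply: integral_ae_eq => //.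
by move=> E _ mE; rewrite -(Radon_Nikodym_SigmaFinite.f_integral dom).
Qed.

(** The translated measure gives each half-open interval its length, and this characterizes Lebesgue
    measure. *)
Lemma ge0_integral_translation (c : R) (f : RR -> \bar R) :
  measurable_fun setT f -> (forall x, 0 <= f x) ->
  \int[leb]_x f (x + c)%R = \int[leb]_x f x.
Proof.
move=> mf f0.
have mt : measurable_fun setT (fun x : RR => (x + c)%R : RR).
  exact: measurable_funD.
have -> : \int[leb]_x f (x + c)%R =
    \int[pushforward leb (fun x : RR => (x + c)%R : RR)]_x f x.
  by rewrite ge0_integral_pushforward// preimage_setT.
apply: eq_measure_integral => A mA _.
pose mtm := isMeasurableFun.Build _ _ _ _ _ mt.
pose t : {mfun RR >-> RR} := HB.pack (fun x : RR => (x + c)%R : RR) mtm.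
apply/esym/(@lebesgue_measure_unique R (pushforward leb t)) => // _ [[a b]] _ <-.
rewrite /= /pushforward /=.
have -> : (fun x : RR => (x + c)%R : RR) @^-1` `]a, b] =
    `](a - c)%R, (b - c)%R]%classic.
  by apply/seteqP; split=> x /=; rewrite !in_itv/= ltrBlDr lerBrDr.
rewrite !lebesgue_measure_itv/= !lte_fin ltrD2r; case: ifPn => // _.
by rewrite -!EFinB; congr EFin; ring.
Qed.

Lemma integral_gaussR_translation (m c : R) (f : RR -> \bar R) :
  measurable_fun setT f -> (forall x, 0 <= f x) ->
  \int[gaussR m]_x f (x + c)%R = \int[gaussR (m + c)%R]_x f x.
Proof.
move=> mf f0.
have mt : measurable_fun setT (fun x : RR => (x + c)%R : RR).
  exact: measurable_funD.
have mft : measurable_fun setT (fun x : RR => f (x + c)%R).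
  exact: (@measurableT_comp _ _ _ _ _ _ f).
rewrite (ge0_integral_gaussR (m + c)%R mf f0).
rewrite (ge0_integral_gaussR m mft) => [|x]; last exact: f0.
rewrite -(@ge0_integral_translation c
  (fun x => f x * (normal_pdf (m + c)%R 1 x)%:E)).
- apply: eq_integral => x _; congr (_ * _%:E).
  rewrite !normal_pdfE//; congr (_ * _)%R; rewrite /normal_fun.
  by rewrite (addrC m c) addrKA.
- apply: emeasurable_funM => //.
  by apply/measurable_EFinP; exact: measurable_normal_pdf.
- by move=> x; rewrite mule_ge0// lee_fin normal_pdf_ge0.
Qed.

(* A shear acts on each line as a translation. *)
Let shear1 (t : R) (f : RR * RR -> \bar R) :
  measurable_fun setT f -> (forall x, 0 <= f x) ->
  \int[leb]_x \int[leb]_y f (x + t * y, y)%R = \int[leb]_x \int[leb]_y f (x, y).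
Proof.
move=> mf f0.
have mg : measurable_fun setT (fun z : RR * RR => f (z.1 + t * z.2, z.2)%R).
  apply: (@measurableT_comp _ _ _ _ _ _ f) => //.
  apply/measurable_fun_pairP; split; last exact: measurable_snd.
  by apply: measurable_funD => //; exact: measurable_funM.
transitivity (\int[leb]_y \int[leb]_x f (x + t * y, y)%R).
  by apply: (fubini_tonelli (fun z : RR * RR => f (z.1 + t * z.2, z.2)%R)).
rewrite (fubini_tonelli f)//; apply: eq_integral => y _.
have mfy : measurable_fun setT (fun x : RR => f (x, y)).
  exact: measurableT_comp.
exact: (@ge0_integral_translation (t * y)%R _ mfy (fun=> f0 _)).
Qed.

Let shear2 (t : R) (f : RR * RR -> \bar R) :
  measurable_fun setT f -> (forall x, 0 <= f x) ->
  \int[leb]_x \int[leb]_y f (x, y + t * x)%R = \int[leb]_x \int[leb]_y f (x, y).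
Proof.
move=> mf f0; apply: eq_integral => x _.
have mfx : measurable_fun setT (fun y : RR => f (x, y)).
  exact: measurableT_comp.
exact: (@ge0_integral_translation (t * x)%R _ mfx (fun=> f0 _)).
Qed.

Let measurable_lin2 (a b c e : R) :
  measurable_fun setT (fun z : RR * RR =>
    (a * z.1 + b * z.2, c * z.1 + e * z.2)%R : RR * RR).
Proof.
apply/measurable_fun_pairP; split => /=;
  by apply: measurable_funD; exact: measurable_funM.
Qed.

(* A rotation is a product of three shears. *)
Let rotation (a b : R) (f : RR * RR -> \bar R) :
  (a ^+ 2 + b ^+ 2 = 1)%R -> b != 0%R ->
  measurable_fun setT f -> (forall x, 0 <= f x) ->
  \int[leb]_x \int[leb]_y f (a * x - b * y, b * x + a * y)%R =
  \int[leb]_x \int[leb]_y f (x, y).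
Proof.
(* For a = cos u and b = sin u, t is - tan (u / 2): the rotation is the shear by t, then by b, then
   by t again. *)
move=> ab1 b0 mf f0; pose t := ((a - 1) / b)%R.
have tb : (t * b = a - 1)%R by rewrite /t; field.
have t2b : (t * (1 + a) = - b)%R.
  rewrite /t -[(a - 1)%R in LHS]opprK opprB mulNr mulNr; congr (- _)%R.
  rewrite mulrAC (_ : (1 - a) * (1 + a) = b ^+ 2)%R; last first.
    by rewrite -[RHS](addrK (a ^+ 2)%R) [(b ^+ 2 + _)%R]addrC ab1; ring.
  by field.
pose f1 z := f (z.1 + t * z.2, z.2)%R.
pose f2 z := f1 (z.1, z.2 + b * z.1)%R.
have mf1 : measurable_fun setT f1.
  apply: (@measurableT_comp _ _ _ _ _ _ f) => //.
  have := measurable_lin2 1 t 0 1; congr measurable_fun.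
  by apply/funext => z; rewrite !mul1r mul0r add0r.
have mf2 : measurable_fun setT f2.
  apply: (@measurableT_comp _ _ _ _ _ _ f1) => //.
  have := measurable_lin2 1 0 b 1; congr measurable_fun.
  by apply/funext => z; rewrite !mul1r mul0r addr0 addrC.
rewrite -(shear1 t mf f0) -[RHS](shear2 b mf1 (fun=> f0 _)).
rewrite -[RHS](shear1 t mf2 (fun=> f0 _)).
apply: eq_integral => x _; apply: eq_integral => y _.
rewrite /f2 /f1 /=; congr (f (_, _)).
- transitivity ((1 + t * b) * x + (t * (1 + (1 + t * b))) * y)%R; last by ring.
  by rewrite tb (addrC 1%R (a - 1)%R) subrK t2b; ring.
- transitivity (b * x + (1 + t * b) * y)%R; last by ring.
  by rewrite tb; ring.
Qed.

(** The joint density of N(m, 1) and N(0, 1) depends only on the distance to (m, 0), and the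
    rotation sends (m, 0) to (a m, b m). So one Gaussian and independent noise become two
    independent Gaussians. *)
Lemma integral_gaussR_rotation (a b m : R) (f : RR * RR -> \bar R) :
  (a ^+ 2 + b ^+ 2 = 1)%R -> b != 0%R ->
  measurable_fun setT f -> (forall x, 0 <= f x) ->
  \int[gaussR m]_x \int[gaussR 0]_y f (a * x - b * y, b * x + a * y)%R =
  \int[gaussR (a * m)%R]_x \int[gaussR (b * m)%R]_y f (x, y).
Proof.
move=> ab1 b0 mf f0.
have mpdf s : measurable_fun setT (fun x : RR => (normal_pdf s 1 x)%:E).
  by apply/measurable_EFinP; exact: measurable_normal_pdf.
have pdf0 s x : 0 <= (normal_pdf s 1 x)%:E :> \bar R.
  by rewrite lee_fin normal_pdf_ge0.
have iterE s1 s2 (g : RR * RR -> \bar R) : measurable_fun setT g ->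
    (forall x, 0 <= g x) -> \int[gaussR s1]_x \int[gaussR s2]_y g (x, y) =
    \int[leb]_x \int[leb]_y
      (g (x, y) * ((normal_pdf s1 1 x)%:E * (normal_pdf s2 1 y)%:E)).
  move=> mg g0; rewrite (@ge0_integral_gaussR s1 (fun x => \int[gaussR s2]_y g (x, y)));
    last 2 first.
  - exact: (measurable_fun_fubini_tonelli_F g).
  - by move=> x; exact: integral_ge0.
  apply: eq_integral => x _.
  have mgx : measurable_fun setT (fun y : RR => g (x, y)).
    exact: measurableT_comp.
  rewrite (ge0_integral_gaussR s2 mgx)// muleC -ge0_integralZl//.
  - by apply: eq_integral => y _; rewrite muleCA.
  - exact: emeasurable_funM.
  - by move=> y _; exact: mule_ge0.
have mrot := measurable_lin2 a (- b) b a.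
have -> : \int[gaussR m]_x \int[gaussR 0]_y
      f (a * x - b * y, b * x + a * y)%R =
    \int[gaussR m]_x \int[gaussR 0]_y
      (f \o (fun z : RR * RR => (a * z.1 + - b * z.2, b * z.1 + a * z.2)%R))
        (x, y).
  by apply: eq_integral => x _; apply: eq_integral => y _ /=; rewrite mulNr.
rewrite (iterE m 0%R _ (measurableT_comp mf mrot) (fun=> f0 _)).
rewrite [RHS](iterE (a * m)%R (b * m)%R f mf f0).
pose G z := f z *
  ((normal_pdf (a * m) 1 z.1)%:E * (normal_pdf (b * m) 1 z.2)%:E).
have mG : measurable_fun setT G.
  apply: emeasurable_funM => //; apply: emeasurable_funM.
    exact: (measurableT_comp (mpdf (a * m)%R)).
  exact: (measurableT_comp (mpdf (b * m)%R)).
have G0 z : 0 <= G z by rewrite mule_ge0// mule_ge0.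
transitivity (\int[leb]_x \int[leb]_y G (a * x - b * y, b * x + a * y)%R);
  last exact: (rotation ab1 b0 mG G0).
apply: eq_integral => x _; apply: eq_integral => y _ /=.
rewrite mulNr /G; congr (_ * _); rewrite -!EFinM; congr EFin.
rewrite !normal_pdfE// mulrACA [RHS]mulrACA; congr (_ * _)%R.
rewrite /normal_fun -!expRD; congr expR.
rewrite expr1n -!mulrDl; congr (_ / _)%R => /=.
transitivity (- ((x - m) ^+ 2 + y ^+ 2) * (a ^+ 2 + b ^+ 2))%R.
  by rewrite ab1; ring.
by ring.
Qed.

End normal_law.

(** * Iterated Gaussian expectations *)

Section measurable_families.
Context (R : realType).

(* A function on sequences is called measurable when it is measurable along
   every family of sequences of constant size with measurable entries; this
   avoids measurable structures on [seq R] and transports along tuples. *)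
Definition mfam dsp (T : measurableType dsp) (z : T -> seq R) :=
  (exists n, forall w, size (z w) = n) /\
  forall i, measurable_fun setT (fun w => nth 0 (z w) i).

(** The parameter space is arbitrary because integrating out a coordinate first adds that coordinate
    to the parameter. *)
Definition mjoint dsp (T : measurableType dsp) (G : T -> seq R -> \bar R) :=
  forall dsp' (T' : measurableType dsp') (p : T' -> T) (z : T' -> seq R),
  measurable_fun setT p -> mfam z -> measurable_fun setT (fun w => G (p w) (z w)).

Definition mseq (F : seq R -> \bar R) :=
  forall dsp (T : measurableType dsp) (z : T -> seq R),
  mfam z -> measurable_fun setT (fun w => F (z w)).

Definition mseq2 (F : seq R -> seq R -> \bar R) :=
  forall dsp (T : measurableType dsp) (z1 z2 : T -> seq R),
  mfam z1 -> mfam z2 -> measurable_fun setT (fun w => F (z1 w) (z2 w)).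

(** One operation serves for the rotated clones, for adding a corruption ([lin 1 1]) and for
    removing it ([lin 1 (-1)]). *)
Definition lin (a b : R) (z g : seq R) : seq R :=
  [seq a * p.1 + b * p.2 | p <- zip z g].

Lemma nth_lin a b z g i : size z = size g ->
  nth 0 (lin a b z g) i = a * nth 0 z i + b * nth 0 g i.
Proof.
elim: z g i => [|x z ih] [|y g] [|i] //=; rewrite /lin/= ?mulr0 ?addr0//.
by move=> [/ih].
Qed.

Lemma size_lin a b z g : size z = size g -> size (lin a b z g) = size z.
Proof. by move=> zg; rewrite size_map size1_zip// zg. Qed.

Section closure.
Context dsp (T : measurableType dsp).
Implicit Types z g : T -> seq R.

Lemma mfam_cst s : mfam (fun _ : T => s).
Proof. by split=> [|i]; [exists (size s)|exact: measurable_cst]. Qed.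

Lemma mfam_cons (f : T -> R) z : measurable_fun setT f -> mfam z ->
  mfam (fun w => f w :: z w).
Proof.
move=> mf [[n zn] mz]; split; first by exists n.+1 => w /=; rewrite zn.
by case=> [|i] //=; exact: mz.
Qed.

Lemma mfam_cat z g : mfam z -> mfam g -> mfam (fun w => z w ++ g w).
Proof.
move=> [[n zn] mz] [[k gk] mg]; split.
  by exists (n + k)%N => w; rewrite size_cat zn gk.
move=> i; under eq_fun do rewrite nth_cat zn.
by case: ltnP => _; [exact: mz|exact: mg].
Qed.

Lemma mfam_lin a b z g : mfam z -> mfam g -> mfam (fun w => lin a b (z w) (g w)).
Proof.
move=> [[n zn] mz] [[k gk] mg]; split.
  by exists (minn n k) => w; rewrite size_map size_zip zn gk.
move=> i; have [lti|lei] := ltnP i (minn n k); last first.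
  under eq_fun do rewrite nth_default ?size_map ?size_zip ?zn ?gk//.
  exact: measurable_cst.
have E w : nth 0 (lin a b (z w) (g w)) i = a * nth 0 (z w) i + b * nth 0 (g w) i.
  rewrite (nth_map (0, 0)) ?size_zip ?zn ?gk//.
  by rewrite nth_zip_cond size_zip zn gk lti.
under eq_fun do rewrite E.
by apply: measurable_funD; exact: measurable_funM.
Qed.

Lemma mfam_comp dsp' (T' : measurableType dsp') (p : T' -> T) z :
  measurable_fun setT p -> mfam z -> mfam (fun w => z (p w)).
Proof.
move=> mp [[n zn] mz]; split; first by exists n.
by move=> i; exact: (measurableT_comp (mz i)).
Qed.

Lemma mfam_tuple n (x : T -> n.-tuple (measurableTypeR R)) :
  measurable_fun setT x -> mfam (fun w => val (x w)).
Proof.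
move=> mx; split; first by exists n => w; exact: size_tuple.
move=> i; have [ltin|leni] := ltnP i n; last first.
  by under eq_fun do rewrite nth_default ?size_tuple//; exact: measurable_cst.
have := measurableT_comp (measurable_tnth (Ordinal ltin)) mx.
by congr measurable_fun; apply/funext => w /=; rewrite (tnth_nth 0).
Qed.

End closure.

Lemma mseq_comp F dsp (T : measurableType dsp) (z : T -> seq R) :
  mseq F -> mfam z -> measurable_fun setT (fun w => F (z w)).
Proof. by move=> /[apply]. Qed.

End measurable_families.

Section iterated_gaussian.
Context (R : realType).
Local Open Scope ereal_scope.
Implicit Types (ms : seq R) (F G : seq R -> \bar R).

(** The expectation of [F] at independent N(m, 1) entries, m running through [ms]. With the means as
    a plain list, all n d coordinates of a data set form one vector, and scaling, shifting or
    concatenating means are list operations. *)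
Fixpoint Eg ms F : \bar R :=
  if ms is m :: ms' then \int[gaussR m]_x Eg ms' (fun z => F (x :: z))
  else F [::].

Lemma Eg_ge0 ms F : (forall z, 0 <= F z) -> 0 <= Eg ms F.
Proof.
by elim: ms F => //= m ms ih F F0; apply: integral_ge0 => x _; exact: ih.
Qed.

Lemma eq_Eg ms F G : (forall z, size z = size ms -> F z = G z) ->
  Eg ms F = Eg ms G.
Proof.
elim: ms F G => /= [|m ms ih] F G FG; first exact: FG.
by apply: eq_integral => x _; apply: ih => z zs; rewrite FG//= zs.
Qed.

Lemma integral_gaussR_cst m (c : \bar R) : \int[gaussR m]_x c = c.
Proof. by rewrite integral_cst// [X in _ * X](@probability_setT _ _ _ (gaussR m)) mule1. Qed.

Lemma Eg_cst ms c : Eg ms (fun=> c) = c.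
Proof.
elim: ms => //= m ms ih.
by rewrite -[RHS](integral_gaussR_cst m); apply: eq_integral => x _; rewrite ih.
Qed.

Lemma Eg_cat ms1 ms2 F :
  Eg (ms1 ++ ms2) F = Eg ms1 (fun z1 => Eg ms2 (fun z2 => F (z1 ++ z2))).
Proof.
by elim: ms1 F => //= m ms1 ih F; apply: eq_integral => x _; rewrite ih.
Qed.

(** Each variable to be integrated is first moved into the parameter, where joint measurability
    allows Tonelli. *)
Lemma measurable_Eg dsp (T : measurableType dsp) ms (G : T -> seq R -> \bar R) :
  mjoint G -> (forall w z, 0 <= G w z) ->
  measurable_fun setT (fun w => Eg ms (G w)).
Proof.
elim: ms dsp T G => [|m ms ih] dsp T G mG G0 /=.
  by apply: mG; [exact: measurable_id|exact: mfam_cst].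
pose H (wx : T * measurableTypeR R) := Eg ms (fun z => G wx.1 (wx.2 :: z)).
apply: (measurable_fun_fubini_tonelli_F H) => [|[w x]]; last exact: Eg_ge0.
apply: (ih _ _ (fun (wx : T * measurableTypeR R) z => G wx.1 (wx.2 :: z))) => //.
move=> dsp' T' p z mp mz.
apply: (mG _ _ (fun w => (p w).1) (fun w => (p w).2 :: z w)).
  exact: measurableT_comp.
by apply: mfam_cons => //; exact: measurableT_comp.
Qed.

Lemma mseq_mjoint F : mseq F ->
  mjoint (fun (x : measurableTypeR R) z => F (x :: z)).
Proof. by move=> mF dsp' T' p z mp mz; apply: mF; exact: mfam_cons. Qed.

Lemma mseq_cons F x : mseq F -> mseq (fun z => F (x :: z)).
Proof.
move=> mF dsp T z mz; apply: (mF _ _ (fun w => x :: z w)).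
exact: (mfam_cons (measurable_cst x)).
Qed.

Lemma measurable_Eg_cons ms F : mseq F -> (forall z, 0 <= F z) ->
  measurable_fun setT
    (fun x : measurableTypeR R => Eg ms (fun z => F (x :: z))).
Proof.
by move=> mF F0; apply: measurable_Eg => //; exact: mseq_mjoint.
Qed.

Lemma mseq_Eg ms (F : seq R -> seq R -> \bar R) : mseq2 F ->
  (forall z g, 0 <= F z g) -> mseq (fun z => Eg ms (F z)).
Proof.
move=> mF F0 dsp T z mz.
apply: (measurable_Eg _ (G := fun w => F (z w))) => //.
by move=> dsp' T' p g mp mg; apply: mF => //; exact: (mfam_comp mp mz).
Qed.

Lemma le_Eg ms F G : mseq F -> mseq G -> (forall z, 0 <= F z) ->
  (forall z, 0 <= G z) ->
  (forall z, size z = size ms -> F z <= G z) -> Eg ms F <= Eg ms G.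
Proof.
elim: ms F G => /= [|m ms ih] F G mF mG F0 G0 FG; first exact: FG.
apply: ge0_le_integral => //.
- by move=> x _; exact: Eg_ge0.
- exact: measurable_Eg_cons.
- exact: measurable_Eg_cons.
move=> x _; apply: ih => //; try exact: mseq_cons.
by move=> z zs; rewrite FG//= zs.
Qed.

Lemma EgD ms F G : mseq F -> mseq G -> (forall z, 0 <= F z) ->
  (forall z, 0 <= G z) ->
  Eg ms (fun z => F z + G z) = Eg ms F + Eg ms G.
Proof.
elim: ms F G => //= m ms ih F G mF mG F0 G0.
rewrite -ge0_integralD//.
- by apply: eq_integral => x _; rewrite ih//; exact: mseq_cons.
- by move=> x _; exact: Eg_ge0.
- exact: measurable_Eg_cons.
- by move=> x _; exact: Eg_ge0.
- exact: measurable_Eg_cons.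
Qed.

Lemma EgZl ms F k : mseq F -> (forall z, 0 <= F z) -> 0 <= k ->
  Eg ms (fun z => k * F z) = k * Eg ms F.
Proof.
move=> + + k0; elim: ms F => //= m ms ih F mF F0.
rewrite -ge0_integralZl//.
- by apply: eq_integral => x _; rewrite ih//; exact: mseq_cons.
- exact: measurable_Eg_cons.
- by move=> x _; exact: Eg_ge0.
Qed.

Lemma EgZr ms F k : mseq F -> (forall z, 0 <= F z) -> 0 <= k ->
  Eg ms (fun z => F z * k) = Eg ms F * k.
Proof.
move=> mF F0 k0; rewrite muleC -EgZl//.
by apply: eq_Eg => z _; rewrite muleC.
Qed.

Lemma Eg_translation ms c F : size c = size ms -> mseq F ->
  (forall z, 0 <= F z) ->
  Eg ms (fun z => F (lin 1 1 z c)) = Eg (lin 1 1 ms c) F.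
Proof.
elim: ms c F => [|m ms ih] [|y c] F //= [cs] mF F0.
rewrite !mul1r -integral_gaussR_translation.
- apply: eq_integral => x _; rewrite -(ih c (fun z => F (x + y :: z)%R))//.
    by apply: eq_Eg => z _; rewrite /lin/= !mul1r.
  exact: mseq_cons.
- exact: measurable_Eg_cons.
- by move=> x; exact: Eg_ge0.
Qed.

Lemma Eg_swap m ms (H : measurableTypeR R -> seq R -> \bar R) :
  mjoint H -> (forall x z, 0 <= H x z) ->
  Eg ms (fun z => \int[gaussR m]_y H y z) = \int[gaussR m]_y Eg ms (H y).
Proof.
elim: ms H => //= n ms ih H mH H0.
pose K (xy : measurableTypeR R * measurableTypeR R) :=
  Eg ms (fun z => H xy.2 (xy.1 :: z)).
transitivity (\int[gaussR n]_x \int[gaussR m]_y K (x, y)).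
  apply: eq_integral => x _; rewrite (ih (fun y z => H y (x :: z)))//.
  move=> dsp T p z mp mz; apply: (mH _ _ p (fun w => x :: z w)) => //.
  exact: (mfam_cons (measurable_cst x)).
rewrite (fubini_tonelli K)// => [|[x y]]; last exact: Eg_ge0.
apply: (measurable_Eg _ (G := fun (xy : measurableTypeR R * measurableTypeR R) z
  => H xy.2 (xy.1 :: z))) => // dsp T p z mp mz.
apply: (mH _ _ (fun w => (p w).2) (fun w => (p w).1 :: z w)).
  exact: measurableT_comp.
by apply: mfam_cons => //; exact: measurableT_comp.
Qed.

(** The noise [g] is integrated after all of [z]; [Eg_swap] brings its first entry next to that of
    [z], so that the plane rotation acts on one pair of coordinates at a time. *)
Lemma Eg_rotation a b ms (F : seq R -> seq R -> \bar R) :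
  (a ^+ 2 + b ^+ 2 = 1)%R -> b != 0%R -> mseq2 F ->
  (forall z g, 0 <= F z g) ->
  Eg ms (fun z => Eg (nseq (size ms) 0%R)
    (fun g => F (lin a (- b) z g) (lin b a z g))) =
  Eg [seq a * m | m <- ms]%R (fun z => Eg [seq b * m | m <- ms]%R (F z)).
Proof.
move=> ab1 b0; elim: ms F => //= m ms ih F mF F0.
pose F' (u v : R) z g := F (u :: z) (v :: g).
have F'0 u v z g : 0 <= F' u v z g by exact: F0.
have mF' u v : mseq2 (F' u v).
  move=> dsp T z g mz mg; apply: mF.
    exact: (mfam_cons (measurable_cst u)).
  exact: (mfam_cons (measurable_cst v)).
pose f (uv : measurableTypeR R * measurableTypeR R) :=
  Eg [seq a * m | m <- ms]%R
    (fun z => Eg [seq b * m | m <- ms]%R (F' uv.1 uv.2 z)).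
have mf : measurable_fun setT f.
  apply: (measurable_Eg _ (G := fun uv : measurableTypeR R * measurableTypeR R =>
    fun z => Eg [seq b * m | m <- ms]%R (F' uv.1 uv.2 z))); last first.
    by move=> w z; exact: Eg_ge0.
  move=> dsp T p z mp mz.
  apply: (measurable_Eg _ (G := fun w => F' (p w).1 (p w).2 (z w))) => //.
  move=> dsp' T' q g mq mg; apply: mF.
    apply: (mfam_cons (f := fun w => (p (q w)).1)).
      apply: (measurableT_comp (f := fst)) => //.
      exact: measurableT_comp.
    exact: (mfam_comp mq mz).
  apply: (mfam_cons (f := fun w => (p (q w)).2)) => //.
  by apply: (measurableT_comp (f := snd)) => //; exact: measurableT_comp.
transitivity (\int[gaussR m]_x \int[gaussR 0]_y
    f (a * x - b * y, b * x + a * y)%R).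
  apply: eq_integral => x _.
  rewrite (Eg_swap _ _ (H := fun y z => Eg (nseq (size ms) 0%R) (fun g =>
     F (lin a (- b) (x :: z) (y :: g)) (lin b a (x :: z) (y :: g))))).
  - apply: eq_integral => y _.
    rewrite -[RHS]/(Eg _ (fun z => Eg _ (F' (a * x - b * y)%R (b * x + a * y)%R z))).
    rewrite -(ih _ (mF' _ _) (F'0 _ _)).
    apply: eq_Eg => z _; apply: eq_Eg => g _.
    by rewrite /lin/= mulNr.
  - move=> dsp T p z mp mz.
    apply: (measurable_Eg _ (G := fun w g => F (lin a (- b) (x :: z w) (p w :: g))
      (lin b a (x :: z w) (p w :: g)))) => //.
    move=> dsp' T' q g mq mg; rewrite /lin/=.
    have mlin1 c e : measurable_fun setT (fun w => c * x + e * p (q w))%R.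
      apply: measurable_funD => //; apply: measurable_funM => //.
      exact: measurableT_comp.
    by apply: mF; apply: mfam_cons => //; apply: mfam_lin => //; exact: (mfam_comp mq mz).
  - by move=> y z; exact: Eg_ge0.
rewrite integral_gaussR_rotation//; last first.
  by move=> uv; apply: Eg_ge0 => z; exact: Eg_ge0.
apply: eq_integral => u _.
rewrite (Eg_swap _ _ (H := fun v z => Eg [seq b * m | m <- ms]%R (F' u v z)))//.
- move=> dsp T p z mp mz.
  apply: (measurable_Eg _ (G := fun w => F' u (p w) (z w))) => //.
  move=> dsp' T' q g mq mg; apply: mF.
    exact: (mfam_cons (measurable_cst u) (mfam_comp mq mz)).
  by apply: (mfam_cons (f := fun w => p (q w))) => //; exact: measurableT_comp.
- by move=> v z; exact: Eg_ge0.
Qed.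

End iterated_gaussian.

(** * Integrals against product laws *)

Section product_law_integrals.
Context (R : realType).
Local Open Scope ereal_scope.

Lemma integral_prod_lawS dsp (T : measurableType dsp) (P : nat -> probability T R)
    n (F : n.+1.-tuple T -> \bar R) :
  measurable_fun setT F -> (forall x, 0 <= F x) ->
  \int[prod_law P n.+1]_x F x =
  \int[P 0%N]_a \int[prod_law (fun i => P i.+1) n]_z F (pcons (a, z)).
Proof.
move=> mF F0 /=; rewrite (ge0_integral_distribution _ mF F0).
rewrite (fubini_tonelli1 (F \o @pcons _ T n))// => [|z]; last exact: F0.
by apply: measurableT_comp => //; exact: measurable_pcons.
Qed.

Lemma integral_prod_law0 dsp (T : measurableType dsp) (P : nat -> probability T R)
    (F : 0.-tuple T -> \bar R) :
  measurable_fun setT F -> \int[prod_law P 0]_x F x = F [tuple].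
Proof. by move=> mF; rewrite /= integral_dirac// diracT mul1e. Qed.

Lemma integral_prod_normal (m : nat -> R) n (F : seq R -> \bar R) :
  mseq F -> (forall z, 0 <= F z) ->
  \int[prod_law (fun j => normal_prob (m j) 1 : probability (measurableTypeR R) R) n]_x F (val x) =
  Eg (mkseq m n) F.
Proof.
elim: n m F => [|n ih] m F mF F0.
  apply: (@integral_prod_law0 _ (measurableTypeR R) _ (fun x => F (val x))).
  exact: (mseq_comp mF (mfam_tuple (@measurable_id _ _ _))).
have mFv : measurable_fun setT
    (fun x : n.+1.-tuple (measurableTypeR R) => F (val x)).
  exact: (mseq_comp mF (mfam_tuple (@measurable_id _ _ _))).
apply: (etrans (integral_prod_lawS _ mFv (fun=> F0 _))).
have -> : mkseq m n.+1 = m 0%N :: mkseq (m \o S) n.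
  by rewrite /mkseq/= -[1%N]addn0 iotaDl -map_comp.
rewrite /= gaussRE; apply: eq_integral => x _.
exact: (ih (m \o S) (fun z => F (x :: z)) (mseq_cons _ mF) (fun=> F0 _)).
Qed.

Lemma integral_gauss d (mu : vect R d) (F : seq R -> \bar R) :
  mseq F -> (forall z, 0 <= F z) ->
  \int[gauss mu]_x F (val x) = Eg (val mu) F.
Proof.
move=> mF F0; rewrite integral_prod_normal//; congr Eg.
by have := mkseq_nth 0%R (val mu); rewrite size_tuple.
Qed.

(** Row-major, the layout of array 1 in [init]; a data set becomes a single list of n d reals. *)
Definition flat n d (X : samples R n d) : seq R := flatten (map val X).

Lemma size_flat n d (X : samples R n d) : size (flat X) = (n * d)%N.
Proof.
rewrite size_flatten /shape -map_comp (@eq_map _ _ _ (fun=> d)); last first.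
  by move=> x /=; rewrite size_tuple.
rewrite sumnE big_map -{2}(size_tuple X).
by elim: (val X) => [|x s ih]; rewrite ?big_nil// big_cons ih mulSn.
Qed.

Lemma nth_flatten_tuples d (s : seq (vect R d)) x0 i (j : 'I_d) :
  (i < size s)%N ->
  nth 0%R (flatten (map val s)) (i * d + j) = nth 0%R (val (nth x0 s i)) j.
Proof.
elim: s i => [|x s ih] [|i] //= lti; rewrite nth_cat size_tuple.
  by rewrite mul0n add0n ltn_ord.
by rewrite mulSn -addnA ltnNge leq_addr /= addKn ih.
Qed.

Lemma nth_flat n d (X : samples R n d) (i : 'I_n) (j : 'I_d) :
  nth 0%R (flat X) (i * d + j) = tnth (tnth X i) j.
Proof.
rewrite (tnth_nth (tnth X i)) (tnth_nth 0%R).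
by rewrite /flat (nth_flatten_tuples (tnth X i))// size_tuple.
Qed.

Lemma mfam_flat dsp (T : measurableType dsp) n d (X : T -> samples R n d) :
  measurable_fun setT X -> mfam (fun w => flat (X w)).
Proof.
move=> mX; split; first by exists (n * d)%N => w; exact: size_flat.
move=> k; have [ltk|lek] := ltnP k (n * d); last first.
  by under eq_fun do rewrite nth_default ?size_flat//; exact: measurable_cst.
have d0 : (0 < d)%N by case: d ltk {X mX} => //; rewrite muln0.
have kn : (k %/ d < n)%N by rewrite ltn_divLR.
have kd : (k %% d < d)%N by rewrite ltn_mod.
have := measurableT_comp (measurable_tnth (Ordinal kd))
  (measurableT_comp (measurable_tnth (Ordinal kn)) mX).
congr measurable_fun; apply/funext => w /=.
by rewrite -(nth_flat (X w) (Ordinal kn) (Ordinal kd)) /= -divn_eq.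
Qed.

Lemma measurable_flat n d (F : seq R -> \bar R) : mseq F ->
  measurable_fun setT (fun X : samples R n d => F (flat X)).
Proof. by move=> mF; exact: (mseq_comp mF (mfam_flat (@measurable_id _ _ _))). Qed.

Lemma mseq_cat F (z : seq R) : mseq F -> mseq (fun g => F (z ++ g)).
Proof.
by move=> mF dsp T g mg; exact: (mseq_comp mF (mfam_cat (mfam_cst _ z) mg)).
Qed.

Lemma mseq_Eg_cat ms F : mseq F -> (forall z, 0 <= F z) ->
  mseq (fun z : seq R => Eg ms (fun g => F (z ++ g))).
Proof.
move=> mF F0; apply: mseq_Eg => // dsp T z g mz mg.
exact: (mseq_comp mF (mfam_cat mz mg)).
Qed.

Lemma integral_iid_gauss n d (mu : vect R d) (F : seq R -> \bar R) :
  mseq F -> (forall z, 0 <= F z) ->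
  \int[iid_law (gauss mu) n]_X F (flat X) = Eg (flatten (nseq n (val mu))) F.
Proof.
rewrite /iid_law; elim: n F => [|n ih] F mF F0.
  apply: (@integral_prod_law0 _ (vect R d) _ (fun X => F (flat X))).
  exact: measurable_flat.
apply: (etrans (integral_prod_lawS _ (measurable_flat mF) (fun=> F0 _))).
rewrite /= Eg_cat -integral_gauss//; last 2 first.
- exact: mseq_Eg_cat.
- by move=> z; exact: Eg_ge0.
apply: eq_integral => x _.
exact: (ih (fun z => F (val x ++ z)) (mseq_cat _ mF) (fun=> F0 _)).
Qed.

Lemma integral_mixture dsp (T : measurableType dsp) (p : R) (P Q : probability T R)
    (F : T -> \bar R) : (0 <= p <= 1)%R ->
  measurable_fun setT F -> (forall x, 0 <= F x) ->
  \int[mixture p P Q]_x F x =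
  (1 - p)%:E * \int[P]_x F x + p%:E * \int[Q]_x F x.
Proof.
move=> p01 mF F0; have /andP[p0 p1] := p01.
have q0 : (0 <= 1 - p)%R by rewrite subr_ge0.
pose m : {measure set T -> \bar R} :=
  measure_add (mscale (NngNum q0) P) (mscale (NngNum p0) Q).
have mE A : mixture p P Q A = m A by rewrite /mixture p01 [RHS]measure_addE.
rewrite (eq_measure_integral m) => [|A mA _]; last exact: mE.
by rewrite ge0_integral_measure_add// !ge0_integral_mscale.
Qed.

(* Expectation over a sequence of n independent Bernoulli(p) labels. *)
Fixpoint Bin (p : R) n (G : seq bool -> \bar R) : \bar R :=
  if n is n'.+1 then (1 - p)%:E * Bin p n' (fun b => G (false :: b)) +
                     p%:E * Bin p n' (fun b => G (true :: b))
  else G [::].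

Lemma Bin_ge0 p n G : (0 <= p <= 1)%R -> (forall b, 0 <= G b) -> 0 <= Bin p n G.
Proof.
move=> /andP[p0 p1]; elim: n G => //= n ih G G0.
by rewrite adde_ge0// mule_ge0 ?ih// lee_fin// subr_ge0.
Qed.

Lemma le_Bin p n G G' : (0 <= p <= 1)%R ->
  (forall b, size b = n -> G b <= G' b) -> Bin p n G <= Bin p n G'.
Proof.
move=> /andP[p0 p1]; elim: n G G' => [|n ih] G G' GG /=; first exact: GG.
by apply: leeD; (apply: lee_pmul2l || apply: lee_wpmul2l);
  rewrite ?lee_fin ?subr_ge0//; apply: ih => b bs; rewrite GG//= bs.
Qed.

Lemma mseq_Bin p n (H : seq R -> seq bool -> \bar R) :
  (forall b, mseq (H^~ b)) -> mseq (fun z => Bin p n (H z)).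
Proof.
elim: n H => [|n ih] H mH dsp T z mz /=; first exact: mH.
apply: emeasurable_funD; apply: measurable_funeM.
  by apply: (ih (fun z b => H z (false :: b))).
by apply: (ih (fun z b => H z (true :: b))).
Qed.

Lemma Eg_Bin p n ms (H : seq R -> seq bool -> \bar R) : (0 <= p <= 1)%R ->
  (forall b, mseq (H^~ b)) -> (forall z b, 0 <= H z b) ->
  Eg ms (fun z => Bin p n (H z)) = Bin p n (fun b => Eg ms (H^~ b)).
Proof.
move=> p01; have /andP[p0 p1] := p01.
elim: n H => //= n ih H mH H0.
have mB c : mseq (fun z => Bin p n (fun b => H z (c :: b))).
  exact: (mseq_Bin _ _ (H := fun z b => H z (c :: b))).
have B0 c z : 0 <= Bin p n (fun b => H z (c :: b)) by exact: Bin_ge0.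
have mZ k c : mseq (fun z => k%:E * Bin p n (fun b => H z (c :: b))).
  by move=> dsp T z mz; apply: measurable_funeM; exact: mB.
rewrite EgD//; last 2 first.
- by move=> z; rewrite mule_ge0// lee_fin subr_ge0.
- by move=> z; rewrite mule_ge0.
by rewrite !EgZl ?lee_fin ?subr_ge0// -!ih.
Qed.

(** This is conditioning on the labels: each sample draws a label and then a Gaussian, and [Eg_Bin]
    moves all labels to the front. *)
Lemma integral_iid_mixture n d p (mu0 mu1 : vect R d) (F : seq R -> \bar R) :
  (0 <= p <= 1)%R -> mseq F -> (forall z, 0 <= F z) ->
  \int[iid_law (mixture p (gauss mu0) (gauss mu1)) n]_X F (flat X) =
  Bin p n (fun b =>
    Eg (flatten [seq (if c then val mu1 else val mu0) | c <- b]) F).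
Proof.
move=> p01; rewrite /iid_law; elim: n F => [|n ih] F mF F0.
  apply: (@integral_prod_law0 _ (vect R d) _ (fun X => F (flat X))).
  exact: measurable_flat.
apply: (etrans (integral_prod_lawS _ (measurable_flat mF) (fun=> F0 _))).
pose G z := Bin p n (fun b =>
  Eg (flatten [seq (if c then val mu1 else val mu0) | c <- b])
    (fun g => F (z ++ g))).
have mH b : mseq (fun z => Eg
    (flatten [seq (if c then val mu1 else val mu0) | c <- b])
    (fun g => F (z ++ g))) by exact: mseq_Eg_cat.
have mG : mseq G by exact: mseq_Bin.
have G0 z : 0 <= G z by apply: Bin_ge0 => // b; exact: Eg_ge0.
transitivity (\int[mixture p (gauss mu0) (gauss mu1)]_x G (val x)).
  apply: eq_integral => x _.
  exact: (ih (fun z => F (val x ++ z)) (mseq_cat _ mF) (fun=> F0 _)).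
have mGv : measurable_fun setT (fun x : vect R d => G (val x)).
  exact: (mseq_comp mG (mfam_tuple (@measurable_id _ _ _))).
apply: (etrans (integral_mixture _ _ p01 mGv (fun=> G0 _))).
rewrite !integral_gauss// /G !Eg_Bin//; try by move=> z b; exact: Eg_ge0.
by congr (_ * Bin _ _ _ + _ * Bin _ _ _); apply/funext => b /=; rewrite Eg_cat.
Qed.

End product_law_integrals.

(** * Expected results of programs *)

Section expected_run.
Context (R : realType).
Implicit Types (l : seq cmd) (h : (nat -> nat) * (nat -> nat -> R) -> \bar R).

Notation mem := ((nat -> nat) * (nat -> nat -> R))%type.
Implicit Types (m : mem) (Q : mem -> Prop).

(* One step from a memory [m], [g] being the number returned by [RGauss]. *)
Definition stepm (g : R) l m : seq cmd * mem :=
  let c := step (l, Store m.1 m.2 (fun=> g)) in (c.1, (reg c.2, arr c.2)).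

Definition reads_tape l : bool := if l is RGauss _ _ :: _ then true else false.

Lemma stepE l m (u : nat -> R) :
  step (l, Store m.1 m.2 u) =
  let c := stepm (u 0%N) l m in
  (c.1, Store c.2.1 c.2.2 (if reads_tape l then (fun i => u i.+1) else u)).
Proof.
case: l => [|[x k|x y|x|x|a x z|a x b y|o a x b y c z|a x|p q|t p q|t p] l] //=;
  by rewrite /stepm/=; case: ifP.
Qed.

Lemma stepm_det g g' l m : ~~ reads_tape l -> stepm g l m = stepm g' l m.
Proof.
by case: l => [|[x k|x y|x|x|a x z|a x b y|o a x b y c z|a x|p q|t p q|t p] l].
Qed.

Lemma stepm_cat g p l1 l2 m :
  stepm g (p :: l1 ++ l2) m = ((stepm g (p :: l1) m).1 ++ l2, (stepm g (p :: l1) m).2).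
Proof.
case: p => [x k|x y|x|x|a x z|a x b y|o a x b y c z|a x|p q|t p q|t p] //=.
by rewrite /stepm/=; case: ifP.
Qed.

Section measurability.
Local Open Scope ereal_scope.

Definition mfamm dsp (T : measurableType dsp) (ar : T -> nat -> nat -> R) :=
  forall a i, measurable_fun setT (fun w => ar w a i).

(** The registers are fixed and only the arrays vary: on a given branch of the control flow,
    registers do not depend on the random numbers. *)
Definition mmem h := forall dsp (T : measurableType dsp) rg
  (ar : T -> nat -> nat -> R), mfamm ar ->
  measurable_fun setT (fun w => h (rg, ar w)).

Lemma mfamm_upd dsp (T : measurableType dsp) (ar : T -> nat -> nat -> R) a i
    (f : T -> R) : mfamm ar -> measurable_fun setT f ->
  mfamm (fun w => upd (ar w) a (upd (ar w a) i (f w))).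
Proof.
move=> mar mf b j; rewrite /upd; case: eqP => _; last exact: mar.
by case: eqP => _ //; exact: mar.
Qed.

Lemma mfamm_comp dsp dsp' (T : measurableType dsp) (T' : measurableType dsp')
    (p : T' -> T) (ar : T -> nat -> nat -> R) :
  measurable_fun setT p -> mfamm ar -> mfamm (fun w => ar (p w)).
Proof. by move=> mp mar a i; exact: (measurableT_comp (mar a i)). Qed.

(** The inverse of 0 is 0, so the map is continuous on an open set and constant on the remaining
    point. *)
Lemma measurable_inv : measurable_fun setT (fun x : R => x^-1%R).
Proof.
have -> : (fun x : R => x^-1%R) = (fun x => if x == 0%R then 0%R else x^-1%R).
  by apply/funext => x; case: eqP => // ->; rewrite invr0.
apply: measurable_fun_if => //.
  by apply: measurable_fun_eqr => //; exact: measurable_cst.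
have -> : setT `&` (fun x : R => x == 0%R) @^-1` [set false] = ~` [set 0%R].
  by apply/seteqP; split=> x /=; [case=> _ /eqP|move=> x0; split => //; apply/eqP].
apply: open_continuous_measurable_fun; first apply: closed_openC.
  exact/accessible_closed_set1/hausdorff_accessible/Rhausdorff.
by move=> x; rewrite inE /= => /eqP x0; exact: inv_continuous.
Qed.

(* The next list of commands and the next registers depend on the random
   quantities through one boolean only. *)
Lemma stepm_family dsp (T : measurableType dsp) p l rg
    (ar : T -> nat -> nat -> R) (g : T -> R) :
  mfamm ar -> measurable_fun setT g ->
  exists (b : T -> bool) l1 l2 rg1 rg2 ar1 ar2,
    [/\ measurable_fun setT b, mfamm ar1, mfamm ar2 &
     forall w, stepm (g w) (p :: l) (rg, ar w) =
       if b w then (l1, (rg1, ar1 w)) else (l2, (rg2, ar2 w))].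
Proof.
move=> mar mg.
have one l1 rg1 ar1 : mfamm ar1 ->
    (forall w, stepm (g w) (p :: l) (rg, ar w) = (l1, (rg1, ar1 w))) ->
    exists (b : T -> bool) l1 l2 rg1 rg2 ar1 ar2,
    [/\ measurable_fun setT b, mfamm ar1, mfamm ar2 &
     forall w, stepm (g w) (p :: l) (rg, ar w) =
       if b w then (l1, (rg1, ar1 w)) else (l2, (rg2, ar2 w))].
  by move=> m1 E; exists (fun=> true), l1, l1, rg1, rg1, ar1, ar1; split.
have mtest t : measurable_fun setT
    (fun w => test_eval t (Store rg (ar w) (fun=> g w))).
  case: t => [x y|a x b y]; first exact: (measurable_cst (rg x < rg y)%N).
  exact: (measurable_fun_ler (mar a (rg x)) (mar b (rg y))).
case: p one => [x k|x y|x|x|a x z|a x b y|o a x b y c z|a x|p q|t p q|t p] one.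
- exact: (one l (upd rg x k) ar mar).
- exact: (one l (upd rg x (rg y)) ar mar).
- exact: (one l (upd rg x (rg x).+1) ar mar).
- exact: (one l (upd rg x (rg x).-1) ar mar).
- exact: (one l rg _ (mfamm_upd a (rg x) mar (measurable_cst (z%:~R%R : R)))).
- exact: (one l rg _ (mfamm_upd a (rg x) mar (mar b (rg y)))).
- have mo : measurable_fun setT
      (fun w => rop_eval o (ar w b (rg y)) (ar w c (rg z))).
    case: o {one} => /=.
    + by apply: measurable_funD; exact: mar.
    + by apply: measurable_funB; exact: mar.
    + by apply: measurable_funM; exact: mar.
    + apply: measurable_funM; first exact: mar.
      exact: (measurableT_comp measurable_inv (mar c (rg z))).
  exact: (one l rg _ (mfamm_upd a (rg x) mar mo)).
- exact: (one l rg _ (mfamm_upd a (rg x) mar mg)).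
- exact: (one [:: p, q & l] rg ar mar).
- exists (fun w => test_eval t (Store rg (ar w) (fun=> g w))),
    (p :: l), (q :: l), rg, rg, ar, ar; split => // w.
  by rewrite /stepm/=; case: ifP.
- exists (fun w => test_eval t (Store rg (ar w) (fun=> g w))),
    [:: p, While t p & l], l, rg, rg, ar, ar; split => // w.
  by rewrite /stepm/=; case: ifP.
Qed.

End measurability.

Lemma stepmE g l m : stepm g l m =
  let c := step (l, Store m.1 m.2 (fun=> g)) in (c.1, (reg c.2, arr c.2)).
Proof. by []. Qed.

(* Keeps [/=] from evaluating the next step; [stepmE] unfolds it on demand. *)
Opaque stepm.

(** The expected value of [h] at the end of a run with fuel [T]. A number is integrated at every
    step, also when the step does not read it; this changes nothing under a probability and avoids
    following the tape. *)
Fixpoint V (T : nat) h l m : \bar R :=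
  if T is T'.+1 then
    if l is [::] then h m
    else (\int[gaussR 0]_g V T' h (stepm g l m).1 (stepm g l m).2)%E
  else h m.

(** [Q] must hold for every outcome of the draws, not only almost surely, in agreement with
    [runs_within]. *)
Fixpoint halts (T : nat) Q l m : Prop :=
  if T is T'.+1 then
    if l is [::] then Q m
    else forall g, halts T' Q (stepm g l m).1 (stepm g l m).2
  else l = [::] /\ Q m.

Lemma V_nil T h m : V T h [::] m = h m. Proof. by case: T. Qed.

Lemma halts_nil T Q m : halts T Q [::] m <-> Q m.
Proof. by case: T => //=; split=> [[]|]. Qed.

Lemma iter_step_nil T (s : store R) : iter T (@step R) ([::], s) = ([::], s).
Proof. by elim: T => //= T ->. Qed.

Lemma halts_tape T l m :
  (forall u, (iter T (@step R) (l, Store m.1 m.2 u)).1 = [::]) <->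
  halts T (fun=> True) l m.
Proof.
elim: T l m => [|T ih] l m.
  by split=> [H|[-> _]]//; split=> //; exact: (H (fun=> 0)).
case: l => [|p l].
  by split=> // _ u; rewrite iter_step_nil.
split=> [H g|H u].
  apply/ih => u.
  (* The tape is lengthened by [g] only when the first command consumes a number. *)
  pose u' := if reads_tape (p :: l) then
    (fun i => if i is j.+1 then u j else g) else u.
  have gE : stepm (u' 0%N) (p :: l) m = stepm g (p :: l) m.
    by rewrite /u'; case: ifPn => // rd; exact: stepm_det.
  have uE : (if reads_tape (p :: l) then (fun i => u' i.+1) else u') = u.
    by rewrite /u'; case: reads_tape.
  by have := H u'; rewrite iterSr stepE gE /= uE.
rewrite iterSr stepE /=; exact: (proj2 (ih _ _) (H _) _).
Qed.

Lemma halts_weaken T T' Q Q' l m : (T <= T')%N -> (forall m', Q m' -> Q' m') ->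
  halts T Q l m -> halts T' Q' l m.
Proof.
move=> + QQ; elim: T T' l m => [|T ih] T' [|p l] m //=.
- by move=> _ [_ Qm]; apply/halts_nil; exact: QQ.
- by move=> _ [].
- by move=> _ Qm; apply/halts_nil; exact: QQ.
- by case: T' => // T' TT H g; apply: ih => //; exact: H.
Qed.

Lemma halts_cat T1 T2 Q1 Q l1 l2 m : halts T1 Q1 l1 m ->
  (forall m', Q1 m' -> halts T2 Q l2 m') -> halts (T1 + T2) Q (l1 ++ l2) m.
Proof.
move=> + H2; elim: T1 l1 m => [|T1 ih] [|p l1] m //=.
- by move=> [_ /H2].
- by move=> [].
- move=> Q1m.
  exact: (halts_weaken (leq_addl T1.+1 T2) (fun _ q => q) (H2 _ Q1m)).
- by move=> H g; rewrite (stepm_cat g p l1 l2 m); apply: ih; exact: H.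
Qed.

Lemma halts_V T T' Q h l m : halts T Q l m -> (T <= T')%N ->
  V T' h l m = V T h l m.
Proof.
elim: T T' l m => [|T ih] T' [|p l] m; rewrite ?V_nil//; first by move=> [].
by case: T' => // T' H TT; apply: eq_integral => g _; exact: ih.
Qed.

Lemma V_cat T1 T2 Q1 Q h l1 l2 m : halts T1 Q1 l1 m ->
  (forall m', Q1 m' -> halts T2 Q l2 m') ->
  V (T1 + T2) h (l1 ++ l2) m = V T1 (fun m' => V T2 h l2 m') l1 m.
Proof.
move=> + H2; elim: T1 l1 m => [|T1 ih] [|p l1] m; first by [].
- by move=> [].
- by move=> /H2/halts_V H; rewrite V_nil; apply: H; rewrite leq_addl.
- move=> H; apply: eq_integral => g _ /=; rewrite (stepm_cat g p l1 l2 m).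
  by apply: ih; exact: H.
Qed.

Lemma eq_V T Q h h' l m : halts T Q l m -> (forall m', Q m' -> h m' = h' m') ->
  V T h l m = V T h' l m.
Proof.
move=> + hh; elim: T l m => [|T ih] [|p l] m //=; try exact: hh.
- by move=> [_ /hh].
- by move=> [].
- by move=> H; apply: eq_integral => g _; exact: ih.
Qed.

Lemma V_cst T c l m : V T (fun=> c) l m = c.
Proof.
elim: T l m => [|T ih] [|p l] m //=.
rewrite -[RHS](integral_gaussR_cst 0); apply: eq_integral => g _; exact: ih.
Qed.

Lemma V_det T Q h c l m : halts T Q l m -> (forall m', Q m' -> h m' = c) ->
  V T h l m = c.
Proof. by move=> H hc; rewrite (eq_V (h' := fun=> c) H hc) V_cst. Qed.

Lemma V_ge0 T h l m : (forall m', 0 <= h m')%E -> (0 <= V T h l m)%E.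
Proof.
move=> h0; elim: T l m => [|T ih] [|p l] m //=.
by apply: integral_ge0 => g _; exact: ih.
Qed.

End expected_run.

Opaque stepm.

Section expected_run_theory.
Context (R : realType).
Notation mem := ((nat -> nat) * (nat -> nat -> R))%type.
Implicit Types (l : seq cmd) (h : mem -> \bar R) (m : mem) (Q : mem -> Prop).
Local Open Scope ereal_scope.

(** Here [h] varies together with the starting memory: an estimate will be compared with data that
    are also the input of the run. *)
Lemma measurable_V_param dsp (W : measurableType dsp) T (h : W -> mem -> \bar R)
    l rg (ar : W -> nat -> nat -> R) :
  (forall dsp' (W' : measurableType dsp') (f : W' -> W) rg ar,
     measurable_fun setT f -> mfamm ar ->
     measurable_fun setT (fun w => h (f w) (rg, ar w))) ->
  (forall w m, 0 <= h w m) -> mfamm ar ->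
  measurable_fun setT (fun w => V T (h w) l (rg, ar w)).
Proof.
elim: T dsp W h l rg ar => [|T ih] dsp W h l rg ar mh h0 mar.
  exact: (mh _ _ id).
case: l => [|p l]; first exact: (mh _ _ id).
pose H (wx : W * measurableTypeR R) := V T (h wx.1)
  (stepm wx.2 (p :: l) (rg, ar wx.1)).1 (stepm wx.2 (p :: l) (rg, ar wx.1)).2.
apply: (measurable_fun_fubini_tonelli_F H) => [|wx]; last exact: V_ge0.
have mar1 : mfamm (fun wx : W * measurableTypeR R => ar wx.1).
  exact: (mfamm_comp measurable_fst mar).
have [b [l1 [l2 [rg1 [rg2 [ar1 [ar2 [mb m1 m2 E]]]]]]]] :=
  stepm_family p l rg mar1 (@measurable_snd _ _ W (measurableTypeR R)).
have -> : H = (fun wx => if b wx then V T (h wx.1) l1 (rg1, ar1 wx)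
                         else V T (h wx.1) l2 (rg2, ar2 wx)).
  by apply/funext => wx; rewrite /H E; case: (b wx).
have mh1 dsp' (W' : measurableType dsp') (f : W' -> W * measurableTypeR R) rg' ar' :
    measurable_fun setT f -> mfamm ar' ->
    measurable_fun setT (fun w => h (f w).1 (rg', ar' w)).
  by move=> mf mar'; apply: (mh _ _ (fun w => (f w).1)) => //; exact: measurableT_comp.
by apply: measurable_fun_ifT => //; apply: (ih _ _ (fun wx => h wx.1)) => //.
Qed.

Lemma measurable_V dsp (W : measurableType dsp) T h l rg
    (ar : W -> nat -> nat -> R) : mmem h -> (forall m, 0 <= h m) -> mfamm ar ->
  measurable_fun setT (fun w => V T h l (rg, ar w)).
Proof.
move=> mh h0 mar; apply: (measurable_V_param T (h := fun=> h)) => //.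
by move=> dsp' W' f rg' ar' _; exact: mh.
Qed.

Lemma measurable_V_step T h p l m : mmem h -> (forall m, 0 <= h m) ->
  measurable_fun setT (fun g : measurableTypeR R =>
    V T h (stepm g (p :: l) m).1 (stepm g (p :: l) m).2).
Proof.
case: m => rg ar mh h0.
have mar : mfamm (fun _ : measurableTypeR R => ar).
  by move=> a i; exact: measurable_cst.
have [b [l1 [l2 [rg1 [rg2 [ar1 [ar2 [mb m1 m2 E]]]]]]]] :=
  stepm_family p l rg mar (@measurable_id _ (measurableTypeR R) setT).
under eq_fun => g.
  have -> : stepm g (p :: l) (rg, ar) =
    if b g then (l1, (rg1, ar1 g)) else (l2, (rg2, ar2 g)) by exact: (E g).
  rewrite (fun_if (fun c => V T h c.1 c.2)) /=.
  over.
by apply: measurable_fun_ifT => //; exact: measurable_V.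
Qed.

Lemma le_V T h h' l m : mmem h -> mmem h' -> (forall m, 0 <= h m) ->
  (forall m, h m <= h' m) -> V T h l m <= V T h' l m.
Proof.
move=> mh mh' h0 hh'; have h'0 m' : 0 <= h' m' by exact: le_trans (hh' _).
elim: T l m => [|T ih] [|p l] m //=.
apply: ge0_le_integral => //; try exact: measurable_V_step.
by move=> g _; exact: V_ge0.
Qed.

Lemma VD T h h' l m : mmem h -> mmem h' -> (forall m, 0 <= h m) ->
  (forall m, 0 <= h' m) ->
  V T (fun m' => h m' + h' m') l m = V T h l m + V T h' l m.
Proof.
move=> mh mh' h0 h'0; elim: T l m => [|T ih] [|p l] m //=.
rewrite -ge0_integralD//; try exact: measurable_V_step;
  try by move=> g _; exact: V_ge0.
by apply: eq_integral => g _; exact: ih.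
Qed.

Lemma VZl T h c l m : mmem h -> (forall m, 0 <= h m) -> 0 <= c ->
  V T (fun m' => c * h m') l m = c * V T h l m.
Proof.
move=> mh h0 c0; elim: T l m => [|T ih] [|p l] m //=.
rewrite -ge0_integralZl//; try exact: measurable_V_step;
  try by move=> g _; exact: V_ge0.
by apply: eq_integral => g _; exact: ih.
Qed.

Definition final T l m (u : nat -> R) : mem :=
  let s := (iter T (@step R) (l, Store m.1 m.2 u)).2 in (reg s, arr s).

Lemma finalS T l m u : final T.+1 l m u =
  final T (stepm (u 0%N) l m).1 (stepm (u 0%N) l m).2
    (if reads_tape l then (fun i => u i.+1) else u).
Proof. by rewrite /final iterSr stepE. Qed.

Lemma measurable_final dsp (W : measurableType dsp) T h l rg
    (ar : W -> nat -> nat -> R) (u : W -> nat -> R) : mmem h -> mfamm ar ->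
  (forall i, measurable_fun setT (fun w => u w i)) ->
  measurable_fun setT (fun w => h (final T l (rg, ar w) (u w))).
Proof.
move=> mh; elim: T l rg ar u => [|T ih] l rg ar u mar mu; first exact: mh.
case: l => [|p l].
  rewrite /final; under eq_fun do rewrite iter_step_nil; exact: mh.
have [b [l1 [l2 [rg1 [rg2 [ar1 [ar2 [mb m1 m2 E]]]]]]]] :=
  stepm_family p l rg mar (mu 0%N).
pose u' w := if reads_tape (p :: l) then (fun i => u w i.+1) else u w.
have mu' i : measurable_fun setT (fun w => u' w i).
  by rewrite /u'; case: reads_tape; exact: mu.
under eq_fun => w.
  rewrite finalS -/(u' w) E.
  rewrite (fun_if (fun c => h (final T c.1 c.2 (u' w)))) /=.
  over.
by apply: measurable_fun_ifT => //; exact: ih.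
Qed.

(** A step that reads consumes the head of the tape, which is one integral of [Eg]; a step that does
    not read integrates a constant in [V]. At most [T] entries are read, and the others integrate to
    one. *)
Lemma Eg_final T N h l m : (T <= N)%N ->
  Eg (nseq N 0%R) (fun z => h (final T l m (nth 0%R z))) = V T h l m.
Proof.
elim: T N l m => [|T ih] N l m TN.
  by rewrite (@eq_Eg _ _ _ (fun=> h m)) ?Eg_cst// => z _; case: m.
case: l => [|p l].
  rewrite (@eq_Eg _ _ _ (fun=> h m)) ?Eg_cst// => z _.
  by rewrite /final iter_step_nil; case: m.
have [rd|rd] := boolP (reads_tape (p :: l)).
  case: N TN => // N TN /=; apply: eq_integral => g _.
  rewrite -(ih N)//; apply: eq_Eg => z _.
  by rewrite finalS rd.
transitivity (\int[gaussR 0]_g V T h (stepm 0 (p :: l) m).1 (stepm 0 (p :: l) m).2).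
  rewrite integral_gaussR_cst -(ih N) ?(ltnW TN)//; apply: eq_Eg => z _.
  by rewrite finalS (negbTE rd) (stepm_det _ 0).
by apply: eq_integral => g _; rewrite (stepm_det g 0).
Qed.

Lemma integral_tape_law T N h l m : (T <= N)%N -> mmem h ->
  (forall m, 0 <= h m) ->
  \int[tape_law R N]_u h (final T l m (nth 0%R (val u))) = V T h l m.
Proof.
move=> TN mh h0; rewrite -(Eg_final h l m TN).
have -> : nseq N 0%R = mkseq (fun=> 0%R : R) N.
  by apply: (@eq_from_nth _ 0%R); rewrite ?size_nseq ?size_mkseq// => i iN;
    rewrite nth_nseq nth_mkseq// iN.
case: m => rg ar.
apply: (integral_prod_normal (fun=> 0%R) N (F := fun z => h (final T l (rg, ar) (nth 0%R z)))) => //.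
move=> dsp W z [_ mz]; apply: (measurable_final T l rg (ar := fun=> ar)) => //.
Qed.

End expected_run_theory.

(** * Running a program on a renamed part of the memory *)

Section relocation.
Context (R : realType).
Notation mem := ((nat -> nat) * (nat -> nat -> R))%type.
Implicit Types (l : seq cmd) (h : mem -> \bar R) (m : mem) (Q : mem -> Prop).

(* Two disjoint copies of the names, both avoiding the names below 16. *)
Definition place (j : bool) (x : nat) : nat := (x.*2 + (16 + j))%N.

Definition unplace (j : bool) (y : nat) : option nat :=
  if (16 <= y)%N && (odd y == j) then Some (y - 16)./2 else None.

Lemma placeK j : pcancel (place j) (unplace j).
Proof.
move=> x; rewrite /unplace /place; case: ifPn => [_|/negP[]]; first congr Some; lia.
Qed.

Lemma unplaceK j y x : unplace j y = Some x -> y = place j x.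
Proof. by rewrite /unplace /place; case: ifP => // H [<-]; case: j H; lia. Qed.

Lemma unplace_other j x : unplace j (place (~~ j) x) = None.
Proof. by rewrite /unplace /place; case: ifP => //; case: j; lia. Qed.

Lemma unplace_small j y : (y < 16)%N -> unplace j y = None.
Proof. by rewrite /unplace ltnNge => /negbTE ->. Qed.

Fixpoint ren (j : bool) (p : cmd) : cmd :=
  let f := place j in
  match p with
  | IConst x k => IConst (f x) k
  | ICopy x y => ICopy (f x) (f y)
  | ISucc x => ISucc (f x)
  | IPred x => IPred (f x)
  | RConst a x z => RConst (f a) (f x) z
  | RCopy a x b y => RCopy (f a) (f x) (f b) (f y)
  | ROp o a x b y c z => ROp o (f a) (f x) (f b) (f y) (f c) (f z)
  | RGauss a x => RGauss (f a) (f x)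
  | Seq p q => Seq (ren j p) (ren j q)
  | If (TLt x y) p q => If (TLt (f x) (f y)) (ren j p) (ren j q)
  | If (TRle a x b y) p q => If (TRle (f a) (f x) (f b) (f y)) (ren j p) (ren j q)
  | While (TLt x y) p => While (TLt (f x) (f y)) (ren j p)
  | While (TRle a x b y) p => While (TRle (f a) (f x) (f b) (f y)) (ren j p)
  end.

Definition proj (j : bool) m : mem :=
  (fun x => m.1 (place j x), fun a => m.2 (place j a)).

Definition merge (j : bool) (m1 m : mem) : mem :=
  (fun y => if unplace j y is Some x then m1.1 x else m.1 y,
   fun a => if unplace j a is Some b then m1.2 b else m.2 a).

Lemma merge_proj j m : merge j (proj j m) m = m.
Proof.
case: m => rg ar; rewrite /merge /proj /=; congr pair; apply/funext => y;
  by case E: (unplace j y) => [x|] //; rewrite -(unplaceK E).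
Qed.

Lemma proj_merge j m1 m : proj j (merge j m1 m) = m1.
Proof.
case: m1 => rg ar; rewrite /merge /proj /=; congr pair; apply/funext => y;
  by rewrite placeK.
Qed.

Lemma merge_merge j m1 m2 m : merge j m1 (merge j m2 m) = merge j m1 m.
Proof.
by rewrite /merge /=; congr pair; apply/funext => y; case: unplace.
Qed.

Lemma proj_merge_other j m1 m : proj (~~ j) (merge j m1 m) = proj (~~ j) m.
Proof.
by rewrite /proj /merge /=; congr pair; apply/funext => y; rewrite unplace_other.
Qed.

Lemma upd_place (T : Type) j (f : nat -> T) x v y :
  (if unplace j y is Some x' then upd (fun x => f (place j x)) x v x' else f y) =
  upd f (place j x) v y.
Proof.
rewrite /upd; case E: (unplace j y) => [x'|].
  by rewrite (unplaceK E) (inj_eq (pcan_inj (placeK j))).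
by case: eqP => // yx; rewrite yx placeK in E.
Qed.

Lemma merge_upd1 j m x v :
  merge j (upd (proj j m).1 x v, (proj j m).2) m = (upd m.1 (place j x) v, m.2).
Proof.
rewrite /merge /=; congr pair; apply/funext => y; first exact: upd_place.
by case E: (unplace j y) => [x'|] //; rewrite (unplaceK E).
Qed.

Lemma merge_upd2 j m a v :
  merge j ((proj j m).1, upd (proj j m).2 a v) m = (m.1, upd m.2 (place j a) v).
Proof.
rewrite /merge /=; congr pair; apply/funext => y; last exact: upd_place.
by case E: (unplace j y) => [x'|] //; rewrite (unplaceK E).
Qed.

Lemma stepm_ren j g l m : stepm g (map (ren j) l) m =
  (map (ren j) (stepm g l (proj j m)).1, merge j (stepm g l (proj j m)).2 m).
Proof.
rewrite !stepmE; case: l => [|p l] /=; first by rewrite merge_proj; case: m.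
case: p => [x k|x y|x|x|a x z|a x b y|o a x b y c z|a x|p q|t p q|t p] /=;
  rewrite ?merge_upd1 ?merge_upd2 ?merge_proj //; try by case: m.
all: by case: t => [x y|a x b y] /=; rewrite /get_arr/=;
  case: ifP => _ /=; rewrite ?merge_proj; case: m.
Qed.

(** A frame rule: renamed code acts on its own copy of the names, and [merge] puts the rest of the
    memory back unchanged. *)
Lemma V_ren T h j l m :
  V T h (map (ren j) l) m = V T (fun m' => h (merge j m' m)) l (proj j m).
Proof.
elim: T l m => [|T ih] [|p l] m; rewrite ?V_nil /= ?merge_proj//.
apply: eq_integral => g _; have := stepm_ren j g (p :: l) m => /= ->.
rewrite ih /= proj_merge; congr (V _ _ _ _); apply/funext => m'.
by rewrite merge_merge.
Qed.

Lemma halts_ren T Q j l m : halts T Q l (proj j m) ->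
  halts T (fun m' => exists2 m1, Q m1 & m' = merge j m1 m) (map (ren j) l) m.
Proof.
elim: T l m => [|T ih] [|p l] m //=.
- by move=> [_ Qm]; split=> //; exists (proj j m); rewrite ?merge_proj.
- by move=> [].
- by move=> Qm; exists (proj j m); rewrite ?merge_proj.
move=> H g; have := stepm_ren j g (p :: l) m => /= -> /=.
have := ih (stepm g (p :: l) (proj j m)).1
  (merge j (stepm g (p :: l) (proj j m)).2 m).
rewrite proj_merge => /(_ (H g)); apply: halts_weaken => // m' [m1 Qm1 ->].
by exists m1 => //; rewrite merge_merge.
Qed.

End relocation.

(** * Program logic *)

Section program_logic.
Context (R : realType).
Notation mem := ((nat -> nat) * (nat -> nat -> R))%type.
Implicit Types (l : seq cmd) (h : mem -> \bar R) (m : mem) (Q : mem -> Prop).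

Definition test_val (t : test) m : bool :=
  match t with
  | TLt x y => (m.1 x < m.1 y)%N
  | TRle a x b y => m.2 a (m.1 x) <= m.2 b (m.1 y)
  end.

Lemma halts_done Q m : Q m -> halts 0 Q [::] m. Proof. by []. Qed.

Lemma halts_IConst T Q x k l m : halts T Q l (upd m.1 x k, m.2) ->
  halts T.+1 Q (IConst x k :: l) m.
Proof. by move=> H g; rewrite stepmE. Qed.

Lemma halts_ICopy T Q x y l m : halts T Q l (upd m.1 x (m.1 y), m.2) ->
  halts T.+1 Q (ICopy x y :: l) m.
Proof. by move=> H g; rewrite stepmE. Qed.

Lemma halts_ISucc T Q x l m : halts T Q l (upd m.1 x (m.1 x).+1, m.2) ->
  halts T.+1 Q (ISucc x :: l) m.
Proof. by move=> H g; rewrite stepmE. Qed.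

Definition wr (ar : nat -> nat -> R) a i v := upd ar a (upd (ar a) i v).

Lemma halts_RConst T Q a x z l m : halts T Q l (m.1, wr m.2 a (m.1 x) z%:~R) ->
  halts T.+1 Q (RConst a x z :: l) m.
Proof. by move=> H g; rewrite stepmE. Qed.

Lemma halts_RCopy T Q a x b y l m :
  halts T Q l (m.1, wr m.2 a (m.1 x) (m.2 b (m.1 y))) ->
  halts T.+1 Q (RCopy a x b y :: l) m.
Proof. by move=> H g; rewrite stepmE. Qed.

Lemma halts_ROp T Q o a x b y c z l m :
  halts T Q l (m.1, wr m.2 a (m.1 x) (rop_eval o (m.2 b (m.1 y)) (m.2 c (m.1 z)))) ->
  halts T.+1 Q (ROp o a x b y c z :: l) m.
Proof. by move=> H g; rewrite stepmE. Qed.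

Lemma halts_Seq T Q p q l m : halts T Q [:: p, q & l] m ->
  halts T.+1 Q (Seq p q :: l) m.
Proof. by case: m => rg ar H g; rewrite stepmE. Qed.

Lemma halts_If T Q t p q l m : halts T Q ((if test_val t m then p else q) :: l) m ->
  halts T.+1 Q (If t p q :: l) m.
Proof. by case: m => rg ar H g; rewrite stepmE; case: t H. Qed.

Lemma halts_While T Q t p l m :
  halts T Q (if test_val t m then [:: p, While t p & l] else l) m ->
  halts T.+1 Q (While t p :: l) m.
Proof.
case: m => rg ar H g; rewrite stepmE.
by case: t H => [x y|a x b y] /=; rewrite /get_arr/=; case: ifP.
Qed.

(** The invariant at [i] decides the test, so the body runs exactly [N] times; each round costs [c]
    and one test, and one more test fails at the end. *)
Lemma halts_loop (I : nat -> mem -> Prop) N c t p T Q l m :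
  (forall i m, I i m -> test_val t m = (i < N)%N) ->
  (forall i m, (i < N)%N -> I i m -> halts c (I i.+1) [:: p] m) ->
  I 0%N m -> (forall m', I N m' -> halts T Q l m') ->
  halts (N * c.+1 + T.+1) Q (While t p :: l) m.
Proof.
move=> It Ip I0 IN.
suff H k i m0 : (i + k = N)%N -> I i m0 ->
    halts (k * c.+1 + T.+1) Q (While t p :: l) m0 by exact: (H N 0%N).
elim: k i m0 => [|k ih] i m0.
  rewrite addn0 mul0n add0n => -> Im; apply: halts_While.
  by rewrite (It _ _ Im) ltnn; exact: IN.
move=> ik Im; have iN : (i < N)%N by rewrite -ik -addSnnS leq_addr.
have -> : (k.+1 * c.+1 + T.+1 = (c + (k * c.+1 + T.+1)).+1)%N by lia.
apply: halts_While; rewrite (It _ _ Im) iN.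
apply: (halts_cat (l1 := [:: p]) (Ip _ _ iN Im)) => m' Im'.
by apply: (ih i.+1) => //; rewrite addSnnS.
Qed.

(* [wp T h l m c]: from memory [m] the commands [l] halt within time [T] and
   the expected value of [h] at the end is [c]. *)
Definition wp T h l m (c : \bar R) := halts T (fun=> True) l m /\ V T h l m = c.

Lemma wp_done h m : wp 0 h [::] m (h m). Proof. by []. Qed.

Lemma wp_weaken T T' h l m c : (T <= T')%N -> wp T h l m c -> wp T' h l m c.
Proof.
move=> TT [H <-]; split; first exact: (halts_weaken TT (fun _ q => q) H).
exact: (halts_V _ H).
Qed.

Lemma wp_step T h p l l' m m' c : (forall g, stepm g (p :: l) m = (l', m')) ->
  wp T h l' m' c -> wp T.+1 h (p :: l) m c.
Proof.
move=> E [H <-]; split=> [g|]; first by rewrite E.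
by rewrite -[RHS](integral_gaussR_cst 0); apply: eq_integral => g _; rewrite E.
Qed.

Lemma wp_Seq T h p q l m c : wp T h [:: p, q & l] m c ->
  wp T.+1 h (Seq p q :: l) m c.
Proof. by case: m => rg ar; apply: wp_step => g; rewrite stepmE. Qed.

Lemma wp_While T h t p l m c :
  wp T h (if test_val t m then [:: p, While t p & l] else l) m c ->
  wp T.+1 h (While t p :: l) m c.
Proof.
case: m => rg ar; apply: wp_step => g; rewrite stepmE.
by case: t => [x y|a x b y] /=; rewrite /get_arr/=; case: ifP.
Qed.

Lemma wp_ISucc T h x l m c : wp T h l (upd m.1 x (m.1 x).+1, m.2) c ->
  wp T.+1 h (ISucc x :: l) m c.
Proof. by apply: wp_step => g; rewrite stepmE. Qed.

Lemma wp_IConst T h x k l m c : wp T h l (upd m.1 x k, m.2) c ->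
  wp T.+1 h (IConst x k :: l) m c.
Proof. by apply: wp_step => g; rewrite stepmE. Qed.

Lemma wp_RGauss T h a x l m (c : R -> \bar R) :
  (forall g, wp T h l (m.1, wr m.2 a (m.1 x) g) (c g)) ->
  wp T.+1 h (RGauss a x :: l) m (\int[gaussR 0]_g c g)%E.
Proof.
move=> H; split=> [g|]; first by rewrite stepmE; case: (H g).
by apply: eq_integral => g _; rewrite stepmE; case: (H g).
Qed.

(** Code whose postcondition already fixes the value [c] of what follows can be treated without
    computing the distribution of its results. *)
Lemma wp_det T1 T2 Q h p l m c : halts T1 Q [:: p] m ->
  (forall m', Q m' -> wp T2 h l m' c) -> wp (T1 + T2) h (p :: l) m c.
Proof.
move=> H1 H2; have H2' m' : Q m' -> halts T2 (fun=> True) l m' by case/H2.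
split; first exact: (halts_cat (l1 := [:: p]) H1).
rewrite (V_cat (l1 := [:: p]) h H1 H2') (V_det H1 (c := c))// => m'.
by case/H2.
Qed.

(** Nothing is known about [p] beyond halting; its effect stays symbolic, as an expectation over the
    part of the memory that it sees. *)
Lemma wp_ren T1 T2 j h H p l m :
  halts T1 (fun=> True) [:: p] (proj j m) ->
  (forall m1, wp T2 h l (merge j m1 m) (H m1)) ->
  wp (T1 + T2) h (ren j p :: l) m (V T1 H [:: p] (proj j m)).
Proof.
move=> H1 H2; have H1' := @halts_ren R _ _ j [:: p] m H1.
have H2' m' : (exists2 m1, True & m' = merge j m1 m) ->
    halts T2 (fun=> True) l m' by move=> [m1 _ ->]; case: (H2 m1).
split; first exact: (halts_cat (l1 := [:: ren j p]) H1').
rewrite (V_cat (l1 := [:: ren j p]) h H1' H2').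
rewrite (V_ren _ _ _ [:: p]); congr (V _ _ _ _); apply/funext => m1.
by case: (H2 m1).
Qed.

Definition fill (a x y : nat) : cmd :=
  While (TLt x y) (Seq (RGauss a x) (ISucc x)).

(** What follows depends on the numbers drawn, so a postcondition is not enough; the induction
    carries the list [gs] of those drawn so far. One round takes four steps. *)
Lemma wp_fill T a x y h H l (rg : nat -> nat) (ar : nat -> nat -> R) :
  x != y -> rg x = 0%N -> ar a = (fun=> 0) ->
  (forall gs, size gs = rg y ->
     wp T h l (upd rg x (rg y), upd ar a (nth 0 gs)) (H gs)) ->
  wp (rg y * 4 + T.+1) h (fill a x y :: l) (rg, ar) (Eg (nseq (rg y) 0) H).
Proof.
move=> xy rx0 ara Hl; have yx : (y == x) = false by rewrite eq_sym (negbTE xy).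
suff W k i gs : (i + k = rg y)%N -> size gs = i ->
    wp (k * 4 + T.+1) h (fill a x y :: l) (upd rg x i, upd ar a (nth 0 gs))
      (Eg (nseq k 0) (fun gs' => H (gs ++ gs'))).
  have := W (rg y) 0%N [::] (add0n _) erefl.
  have -> : upd rg x 0 = rg.
    by apply/funext => z; rewrite /upd; case: eqP => // ->.
  have -> // : upd ar a (nth 0 [::]) = ar.
  apply/funext => b; rewrite /upd; case: eqP => // ->.
  by rewrite ara; apply/funext => -[].
elim: k i gs => [|k ih] i gs.
  rewrite addn0 mul0n add0n => iN gsi; apply: wp_While.
  rewrite /= /upd yx eqxx iN ltnn -/(upd rg x (rg y)) cats0.
  by apply: Hl; rewrite gsi.
move=> iN gsi; have ltiN : (i < rg y)%N by rewrite -iN -addSnnS leq_addr.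
have -> : (k.+1 * 4 + T.+1 = (k * 4 + T.+1).+4)%N by lia.
apply: wp_While; rewrite /= {1 2}/upd yx eqxx ltiN.
apply: wp_Seq; apply: wp_RGauss => g; apply: wp_ISucc => /=.
have -> : (fun gs' => H (gs ++ g :: gs')) = (fun gs' => H (rcons gs g ++ gs')).
  by apply/funext => gs'; rewrite cat_rcons.
have -> : upd (upd rg x i) x (upd rg x i x).+1 = upd rg x i.+1.
  by apply/funext => z; rewrite /upd eqxx; case: eqP.
have -> : wr (upd ar a (nth 0 gs)) a (upd rg x i x) g =
    upd ar a (nth 0 (rcons gs g)).
  apply/funext => b; rewrite /wr /upd !eqxx; case: eqP => // _.
  apply/funext => z; rewrite nth_rcons gsi; case: ltngtP => // zi.
  by rewrite nth_default// gsi ltnW.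
by apply: ih; rewrite ?size_rcons ?gsi// addSnnS.
Qed.

End program_logic.

(** * Gaussian cloning *)

Arguments halts : simpl never.
Arguments V : simpl never.

Notation "p ;; q" := (Seq p q) (at level 61, right associativity, only parsing).

(* Naming each intermediate array memory keeps the terms linear in the length
   of the code. *)
Lemma set_cell (R : realType) T Q l rg (ar : nat -> nat -> R) a x v :
  (forall ar', (forall e i, ar' e i = if (e == a) && (i == x) then v else ar e i) ->
     halts T Q l (rg, ar')) ->
  halts T Q l (rg, wr ar a x v).
Proof.
apply => e i; rewrite /wr /upd; case: eqP => // ->.
by case: eqP.
Qed.

Ltac straight1 :=
  lazymatch goal with
  | |- halts _ _ (Seq _ _ :: _) _ => apply: halts_Seq
  | |- halts _ _ (IConst _ _ :: _) _ => apply: halts_IConst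
  | |- halts _ _ (ICopy _ _ :: _) _ => apply: halts_ICopy
  | |- halts _ _ (ISucc _ :: _) _ => apply: halts_ISucc
  | |- halts _ _ (RConst _ _ _ :: _) _ =>
      apply: halts_RConst; apply: set_cell => ? ?
  | |- halts _ _ (RCopy _ _ _ _ :: _) _ =>
      apply: halts_RCopy; apply: set_cell => ? ?
  | |- halts _ _ (ROp _ _ _ _ _ _ _ :: _) _ =>
      apply: halts_ROp; apply: set_cell => ? ?
  end.
Ltac straight := repeat straight1.

Ltac cells := repeat (match goal with
  | E : forall e i, ?ar e i = (if _ then _ else _) |- context [?ar _ _] =>
      rewrite !E end; rewrite /= /upd /=).

Ltac cells_at r := repeat (match goal with
  | E : forall e i, ?ar e i = (if _ then _ else _) |- context [?ar _ _] =>
      rewrite !E end; rewrite /= /upd /= ?r /=).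

Section stage.
Context (R : realType).
Notation mem := ((nat -> nat) * (nat -> nat -> R))%type.

(** As n + d + 2 >= 2, the factor 2^c is absorbed by c more powers; two powers absorb n d + n + d +
    1, and three the factor 2 that comes from replacing the sum by a product. *)
Lemma time_bound_ge (c k n d T : nat) :
  (T <= 2 ^ c * ((n + d + 2) ^ k + n * d + n + d + 1))%N ->
  (T <= time_bound (k + c + 5) n d)%N.
Proof.
move=> TT; apply: (leq_trans TT); rewrite /time_bound.
set s := (n + d + 2)%N; have s2 : (2 <= s)%N by rewrite leq_addl.
have s0 : (0 < s)%N by apply: leq_trans s2.
have c1 : (2 ^ c <= s ^ c)%N by case: c {TT} => // c; rewrite leq_exp2r.
have -> : (k + c + 5 = c + (k + (2 + 3)))%N by lia.
rewrite !expnD leq_mul//.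
have sk : (1 <= s ^ k)%N by rewrite expn_gt0 s0.
have ss : (n * d + n + d + 1 <= s ^ 2)%N by rewrite /s; nia.
have s3 : (2 ^ 3 <= s ^ 3)%N by rewrite leq_exp2r.
have q1 : (1 <= s ^ 2)%N by rewrite expn_gt0 s0.
apply: (@leq_trans (s ^ k * (s ^ 2 * 2))%N).
  by move: (s ^ k)%N (s ^ 2)%N sk ss q1 => x y; nia.
by rewrite leq_mul// leq_mul// (leq_trans _ s3).
Qed.

Definition imem n d (a b : R) (z : seq R) : mem :=
  (nth 0%N [:: n; d], fun i => nth 0 (nth [::] [:: [:: a; b]; z] i)).

Definition hwithin (p : cmd) (k : nat) : Prop :=
  forall n d (a b : R) (z : seq R), size z = (n * d)%N ->
    halts (time_bound k n d) (fun=> True) [:: p] (imem n d a b z).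

Definition accb (m : mem) : \bar R := ((0 < m.2 2%N 0%N)%R%:R)%:E.

Definition acc (p : cmd) k n d (a b : R) (z : seq R) : \bar R :=
  V (time_bound k n d) accb [:: p] (imem n d a b z).

(** Registers can only count, so n d is obtained in register 3 by a double loop of increments. *)
Definition size_prog : cmd :=
  While (TLt 4 0) (IConst 5 0 ;;
    While (TLt 5 1) (ISucc 3 ;; ISucc 5) ;; ISucc 4).

Lemma halts_size_prog n d (m : mem) : m.1 0%N = n -> m.1 1%N = d ->
  m.1 3%N = 0%N -> m.1 4%N = 0%N ->
  halts (n * (d * 4 + 2).+4 + 1) (fun m' => [/\ m'.2 = m.2, m'.1 3%N = (n * d)%N &
    forall x, x \notin [:: 3; 4; 5]%N -> m'.1 x = m.1 x]) [:: size_prog] m.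
Proof.
move=> r0 r1 r3 r4.
apply: (halts_loop (I := fun i m' => [/\ m'.2 = m.2, m'.1 4%N = i,
  m'.1 3%N = (i * d)%N & forall x, x \notin [:: 3; 4; 5]%N -> m'.1 x = m.1 x])).
- by move=> i m' [_ /= -> _ /(_ 0%N)->//]; rewrite r0.
- move=> i m' iN [ar4 i4 i3 oth]; straight.
  apply: (halts_loop (I := fun j m'' => [/\ m''.2 = m.2, m''.1 4%N = i,
    m''.1 3%N = (i * d + j)%N, m''.1 5%N = j &
    forall x, x \notin [:: 3; 4; 5]%N -> m''.1 x = m.1 x])).
  + by move=> j m'' [_ _ _ /= -> /(_ 1%N)->//]; rewrite r1.
  + move=> j m'' jd [ar5 j4 j3 j5 oth']; straight; apply: halts_done.
    split => //=; rewrite /upd/= ?j3 ?j5 ?addnS//.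
    move=> x xN; rewrite -oth'//; move: xN; rewrite !inE !negb_or.
    by case/and3P => /negbTE-> /negbTE _ /negbTE->.
  + split => //=; rewrite /upd/= ?addn0//.
    move=> x xN; rewrite -oth//; move: xN; rewrite !inE !negb_or.
    by case/and3P => _ _ /negbTE->.
  + move=> m'' [ar5 j4 j3 j5 oth']; straight; apply: halts_done.
    split => //=; rewrite /upd/= ?j3 ?j4 ?mulSn ?(addnC d)//.
    move=> x xN; rewrite -oth'//; move: xN; rewrite !inE !negb_or.
    by case/and3P => _ /negbTE-> _.
- by split => //; rewrite mul0n.
- by move=> m' [ar4 i4 i3 oth]; apply: halts_done.
Qed.

(** In the Pythagorean triple 119, 120, 169 the legs differ by one: the two clones keep nearly equal
    shares of the mean, and both entries are quotients of integer constants. *)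
Definition cosR : R := 119%:R / 169%:R.
Definition sinR : R := 120%:R / 169%:R.

(** Array 1 holds the data and array 3 the noise. The names 16 to 19 are the images of 0 and 1 under
    [place], where the two renamed copies expect n, d, the parameters and their data. Register 2 is
    never written and serves as index 0. *)
Definition clone_prog : cmd :=
  RConst 5 2 119 ;; RConst 7 2 169 ;; ROp Rdiv 5 2 5 2 7 2 ;;
  RConst 6 2 120 ;; ROp Rdiv 6 2 6 2 7 2 ;; IConst 4 0 ;;
  While (TLt 4 3) (
    ROp Rmul 4 2 5 2 1 4 ;; ROp Rmul 7 2 6 2 3 4 ;; ROp Rsub 18 4 4 2 7 2 ;;
    ROp Rmul 4 2 6 2 1 4 ;; ROp Rmul 7 2 5 2 3 4 ;; ROp Radd 19 4 4 2 7 2 ;;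
    ISucc 4) ;;
  ICopy 16 0 ;; ICopy 18 1 ;; ICopy 17 0 ;; ICopy 19 1 ;; IConst 6 1 ;;
  RCopy 16 2 0 2 ;; RCopy 16 6 0 6 ;; RCopy 17 2 0 2 ;; RCopy 17 6 0 6.

Lemma halts_clone_prog n d a b (z g : seq R) (m : mem) :
  m.1 0%N = n -> m.1 1%N = d -> m.1 2%N = 0%N -> m.1 3%N = (n * d)%N ->
  (forall x, (16 <= x)%N -> m.1 x = 0%N) ->
  m.2 0%N =1 nth 0 [:: a; b] -> m.2 1%N =1 nth 0 z -> m.2 3%N =1 nth 0 g ->
  (forall x k, (4 <= x)%N || (x == 2%N) -> m.2 x k = 0) ->
  size z = (n * d)%N -> size g = (n * d)%N ->
  halts (n * d * 14 + 31) (fun m' => [/\ m'.1 2%N = 0%N, m'.2 8%N 0%N = 0,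
    m'.2 2%N 0%N = 0,
    proj false m' = imem n d a b (lin cosR (- sinR) z g) &
    proj true m' = imem n d a b (lin sinR cosR z g)]) [:: clone_prog] m.
Proof.
move=> r0 r1 r2 r3 r16 a0 a1 a3 aoth sz sg.
rewrite /clone_prog.
have -> : (n * d * 14 + 31 = (n * d * 14 + 18).+4.+4.+4.+1)%N by lia.
straight.
apply: (halts_loop (I := fun i m' => [/\ m'.1 4%N = i,
   (forall x, x != 4%N -> m'.1 x = m.1 x),
   m'.2 5%N 0%N = cosR, m'.2 6%N 0%N = sinR &
   [/\ (forall c k, c \notin [:: 4; 5; 6; 7; 18; 19]%N -> m'.2 c k = m.2 c k),
   (forall k, m'.2 18%N k =
      if (k < i)%N then cosR * nth 0 z k - sinR * nth 0 g k else 0) &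
   (forall k, m'.2 19%N k =
      if (k < i)%N then sinR * nth 0 z k + cosR * nth 0 g k else 0)]])).
- by move=> i m' [/= -> /(_ 3%N)->//]; rewrite r3.
- move=> i [rg' ar'] iN /= [r4 oth A5 B6 [aoth' a18 a19]].
  have r2' : rg' 2%N = 0%N by rewrite oth.
  have a1' k : ar' 1%N k = nth 0 z k by rewrite aoth'.
  have a3' k : ar' 3%N k = nth 0 g k by rewrite aoth'.
  straight; apply: halts_done.
  split => //=; try by cells; rewrite ?r2' ?r4.
    by move=> x xN; rewrite /upd (negbTE xN) oth.
  split=> [c k||].
  + rewrite !inE !negb_or => cN; cells; rewrite -aoth' ?inE ?negb_or//.
    case/and5P: cN => /negbTE n4 _ _ /negbTE n7 /andP[/negbTE n18 /negbTE n19].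
    by rewrite n4 n7 n18 n19.
  + move=> k; cells; rewrite r2' r4 /= A5 B6 a1' a3' a18 ltnS (leq_eqVlt k i).
    by case: eqP => [->|_].
  + move=> k; cells; rewrite r2' r4 /= A5 B6 a1' a3' a19 ltnS (leq_eqVlt k i).
    by case: eqP => [->|_].
- split => //=; try by cells; rewrite ?r2.
  + by move=> x xN; rewrite /upd (negbTE xN).
  + split=> [c k||].
    * rewrite !inE !negb_or => cN; cells.
      by case/and5P: cN => /negbTE n4 /negbTE n5 /negbTE n6 /negbTE n7 _;
        rewrite n5 n6 n7.
    * by move=> k; cells; rewrite aoth.
    * by move=> k; cells; rewrite aoth.
- move=> [rg' ar'] /= [r4 oth A5 B6 [aoth' a18 a19]].
  have r2' : rg' 2%N = 0%N by rewrite oth.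
  have a0' k : ar' 0%N k = nth 0 [:: a; b] k by rewrite aoth'.
  straight; apply: halts_done.
  split => //=; try by cells; rewrite ?aoth' ?aoth//.
  + rewrite /proj /imem /=; congr pair; apply/funext => -[|[|x]] //=.
    * by rewrite /upd /= oth.
    * by rewrite /upd /= oth.
    * rewrite /upd; do ![rewrite ifN; last by rewrite /place; lia].
      rewrite nth_nil oth; last by rewrite /place; lia.
      by rewrite r16// /place; lia.
    * apply/funext => k; cells.
      rewrite r2' !a0'; case: k => [|[|k]] //=.
      by rewrite aoth'// aoth// nth_nil.
    * apply/funext => k; cells; rewrite a18 nth_lin ?sz ?sg// mulNr.
      by case: ltnP => // kN; rewrite !nth_default ?sz ?sg// !mulr0 subr0.
    * apply/funext => k; cells.
      do ![rewrite ifN; last by rewrite negb_and /place; apply/orP; left; lia].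
      rewrite !nth_nil aoth'; last by rewrite /place !inE; lia.
      by rewrite aoth// /place; lia.
  + rewrite /proj /imem /=; congr pair; apply/funext => -[|[|x]] //=.
    * by rewrite /upd /= oth.
    * by rewrite /upd /= oth.
    * rewrite /upd; do ![rewrite ifN; last by rewrite /place; lia].
      rewrite nth_nil oth; last by rewrite /place; lia.
      by rewrite r16// /place; lia.
    * apply/funext => k; cells.
      rewrite r2' !a0'; case: k => [|[|k]] //=.
      by rewrite aoth'// aoth// nth_nil.
    * apply/funext => k; cells; rewrite a19 nth_lin ?sz ?sg//.
      by case: ltnP => // kN; rewrite !nth_default ?sz ?sg// !mulr0 addr0.
    * apply/funext => k; cells.
      do ![rewrite ifN; last by rewrite negb_and /place; apply/orP; left; lia].
      rewrite !nth_nil aoth'; last by rewrite /place !inE; lia.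
      by rewrite aoth// /place; lia.
Qed.

End stage.

Section stage_program.
Context (R : realType).
Notation mem := ((nat -> nat) * (nat -> nat -> R))%type.
Local Open Scope ereal_scope.

Lemma accb_ge0 (m : mem) : 0 <= accb m. Proof. by rewrite lee_fin. Qed.

Lemma mmem_accb : mmem (@accb R).
Proof.
move=> dsp W rg ar mar; rewrite /accb /=.
have -> : (fun w => (0 < ar w 2%N 0%N)%R%:R%:E) =
    (fun w => if (0 < ar w 2%N 0%N)%R then 1 else 0) :> (W -> \bar R).
  by apply/funext => w; case: ifP.
apply: measurable_fun_ifT => //; apply: measurable_fun_ltr => //; exact: mar.
Qed.

Lemma mfamm_imem dsp (W : measurableType dsp) n d (a b : R) (z : W -> seq R) :
  mfam z -> mfamm (fun w => (imem n d a b (z w)).2).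
Proof.
by move=> [_ mz] [|[|i]] j /=; [exact: measurable_cst|exact: mz|exact: measurable_cst].
Qed.

Lemma mseq_V T h l n d (a b : R) : mmem h -> (forall m, 0 <= h m) ->
  mseq (fun z => V T h l (imem n d a b z)).
Proof.
by move=> mh h0 dsp W z mz; exact: (measurable_V T l _ mh h0 (mfamm_imem n d a b mz)).
Qed.

Lemma mseq_acc p k n d (a b : R) : mseq (acc p k n d a b).
Proof. by apply: mseq_V; [exact: mmem_accb|exact: accb_ge0]. Qed.

Lemma acc_ge0 p k n d (a b : R) z : 0 <= acc p k n d a b z.
Proof. by apply: V_ge0 => m; exact: accb_ge0. Qed.

(** Arrays 20 and 21 are the output arrays of the two copies. Setting register 15 leaves the arrays
    alone, so the output stays 0 and the answer is rejection. *)
Definition and_prog : cmd :=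
  If (TRle 20 2 8 2) (IConst 15 0)
    (If (TRle 21 2 8 2) (IConst 15 0) (RConst 2 2 1)).

Lemma halts_and_prog (m : mem) : m.1 2%N = 0%N -> m.2 8%N 0%N = 0%R ->
  m.2 2%N 0%N = 0%R ->
  halts 3 (fun m' => accb m' = (0 < m.2 20%N 0%N)%R%:R%:E * (0 < m.2 21%N 0%N)%R%:R%:E)
    [:: and_prog] m.
Proof.
move=> r2 a8 a2; apply: halts_If; rewrite /test_val r2 a8.
case: (ltP 0%R (m.2 20%N 0%N)) => _ /=; last first.
  apply: halts_IConst; rewrite mul0e; apply/halts_nil.
  by rewrite /accb /= a2 ltxx.
apply: halts_If; rewrite /test_val r2 a8 mul1e.
case: (ltP 0%R (m.2 21%N 0%N)) => _ /=.
  apply: halts_RConst; apply: halts_done.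
  by rewrite /accb /wr /upd/= r2 ltr01.
apply: halts_IConst; apply: halts_done; by rewrite /accb /= a2 ltxx.
Qed.

Definition stage (p : cmd) : cmd :=
  size_prog ;; IConst 4 0 ;; fill 3 4 3 ;; clone_prog ;;
  ren false p ;; ren true p ;; and_prog.

Lemma wp_stage p k n d (a b : R) z : hwithin R p k -> size z = (n * d)%N ->
  wp (time_bound (k + 7 + 5) n d) (@accb R) [:: stage p] (imem n d a b z)
    (Eg (nseq (n * d) 0%R) (fun g =>
      V (time_bound k n d) (fun m1 =>
        V (time_bound k n d) (fun m2 => accb m1 * accb m2) [:: p]
          (imem n d a b (lin (sinR R) (cosR R) z g))) [:: p]
        (imem n d a b (lin (cosR R) (- sinR R) z g)))).
Proof.
move=> Hp sz.
have Hp' z' : size z' = (n * d)%N ->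
  halts (time_bound k n d) (fun=> True) [:: p] (imem n d a b z') by exact: Hp.
apply: (wp_weaken (T := ((n * (d * 4 + 2).+4 + 1) + (n * d * 4 +
  ((n * d * 14 + 31) + (time_bound k n d + (time_bound k n d + (3 + 0)).+1).+1).+1.+1).+3).+1)).
  (* The exponent 7 is chosen so that 2^7 dominates all coefficients of the step count. *)
  apply: time_bound_ge; rewrite /time_bound.
  by move: ((n + d + 2) ^ k)%N => x; lia.
apply: wp_Seq; apply: wp_det.
  exact: (halts_size_prog (n := n) (d := d)).
move=> m1 [ar1 r13 oth1].
apply: wp_Seq; apply: wp_IConst.
have NE : (n * d = upd m1.1 4 0 3)%N by rewrite /upd /= r13.
apply: wp_Seq; rewrite {1 3}NE; apply: wp_fill => //.
  by rewrite ar1 /=; apply/funext => i; rewrite nth_nil.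
rewrite -NE => g sg; apply: wp_Seq.
apply: wp_det.
  apply: (halts_clone_prog (n := n) (d := d) (a := a) (b := b) (z := z) (g := g)) => //=.
  - by rewrite /upd /= oth1.
  - by rewrite /upd /= oth1.
  - by rewrite /upd /= oth1.
  - move=> x x16; rewrite /upd; case: eqP => [x4|x4]; first by move: x16; rewrite x4.
    rewrite oth1; last by rewrite !inE; lia.
    by case: x x16 x4 => [|[|x]]//= _ _; rewrite nth_nil.
  - by move=> i; rewrite /upd /= ar1.
  - by move=> i; rewrite /upd /= ar1.
  - move=> x i x4; rewrite /upd ifN; last by move: x4; lia.
    by rewrite ar1; case: x x4 => [|[|x]]//= _; rewrite nth_nil nth_nil.
move=> m2 [r2 a8 a2 P1 P2].
have s1 : size (lin (cosR R) (- sinR R) z g) = (n * d)%N by rewrite size_lin ?sz.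
have s2 : size (lin (sinR R) (cosR R) z g) = (n * d)%N by rewrite size_lin ?sz.
apply: wp_Seq; rewrite -P1; apply: wp_ren; first by rewrite P1; exact: Hp'.
move=> m3; apply: wp_Seq.
have PM : proj true (merge false m3 m2) = proj true m2.
  exact: (proj_merge_other false m3 m2).
rewrite -P2 -PM; apply: wp_ren; first by rewrite PM P2; exact: Hp'.
move=> m4; apply: wp_det; first exact: halts_and_prog.
by move=> m5 <-; exact: wp_done.
Qed.

Lemma hwithin_stage p k : hwithin R p k -> hwithin R (stage p) (k + 7 + 5).
Proof. by move=> Hp n d a b z sz; case: (wp_stage a b Hp sz). Qed.

(** The copies draw different random numbers, so for a fixed [g] they accept independently. *)
Lemma acc_stage p k n d (a b : R) z : hwithin R p k -> size z = (n * d)%N ->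
  acc (stage p) (k + 7 + 5) n d a b z =
  Eg (nseq (n * d) 0%R) (fun g =>
    acc p k n d a b (lin (cosR R) (- sinR R) z g) *
    acc p k n d a b (lin (sinR R) (cosR R) z g)).
Proof.
move=> Hp sz; have [_ E] := wp_stage a b Hp sz; rewrite /acc E.
apply: eq_Eg => g _.
have mA := mmem_accb; have A0 := accb_ge0.
transitivity (V (time_bound k n d) (fun m1 => acc p k n d a b
  (lin (sinR R) (cosR R) z g) * accb m1) [:: p]
  (imem n d a b (lin (cosR R) (- sinR R) z g))).
  congr (V _ _ _ _); apply/funext => m1; rewrite VZl//.
  by rewrite muleC.
by rewrite VZl ?acc_ge0// muleC.
Qed.

Lemma cos_sin : (cosR R ^+ 2 + sinR R ^+ 2 = 1)%R.
Proof. by rewrite /cosR /sinR; field. Qed.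

(** Averaged over data and noise, the two inputs are themselves independent by rotation invariance.
    As this holds for any list of means, it applies to null data and to planted data with fixed
    labels alike. *)
Lemma Eg_acc_stage p k n d (a b : R) ms : hwithin R p k ->
  size ms = (n * d)%N ->
  Eg ms (acc (stage p) (k + 7 + 5) n d a b) =
  Eg [seq cosR R * m | m <- ms]%R (acc p k n d a b) *
  Eg [seq sinR R * m | m <- ms]%R (acc p k n d a b).
Proof.
move=> Hp sms; have mA := mseq_acc p k n d a b; have A0 := acc_ge0 p k n d a b.
pose F z1 z2 := acc p k n d a b z1 * acc p k n d a b z2.
transitivity (Eg ms (fun z => Eg (nseq (size ms) 0%R) (fun g =>
    F (lin (cosR R) (- sinR R) z g) (lin (sinR R) (cosR R) z g)))).
  by apply: eq_Eg => z zs; rewrite acc_stage ?sms// zs.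
rewrite Eg_rotation.
- transitivity (Eg [seq cosR R * m | m <- ms]%R (fun z1 => acc p k n d a b z1 *
    Eg [seq sinR R * m | m <- ms]%R (acc p k n d a b))).
    by apply: eq_Eg => z1 _; rewrite /F EgZl.
  by rewrite EgZr//; exact: Eg_ge0.
- exact: cos_sin.
- by rewrite /sinR mulf_neq0// ?invr_eq0 pnatr_eq0.
- by move=> dsp W z1 z2 mz1 mz2; apply: emeasurable_funM; exact: mA.
- by move=> z1 z2; exact: mule_ge0.
Qed.

End stage_program.

(** * The distance test *)

Section base_program.
Context (R : realType).
Notation mem := ((nat -> nat) * (nat -> nat -> R))%type.

(** With a = eta and b = C alpha / eta this gives back alpha: the distinguisher receives the
    separation, while the estimator expects the error. *)
Definition alphaR (a b : R) : R :=
  iter 5 (fun t => t * 120%:R / 169%:R) (b * a) / 21%:R.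

(** Squares are compared, since programs have no square root; [e] is the estimate. *)
Definition far n d (al : R) (z : seq R) (e : nat -> R) : bool :=
  al * al < \sum_(j < d) (e j - (\sum_(i < n) nth 0 z (i * d + j)) / n%:R) ^+ 2.

(** Rebuilds the input of the estimator in the copy [false], with alpha instead of the separation as
    second parameter; the five factors 120/169 are those of [alphaR]. *)
Definition prep_prog : cmd :=
  IConst 6 1 ;; RConst 5 2 120 ;; RConst 7 2 169 ;; RConst 13 2 21 ;;
  RConst 8 2 1 ;; ROp Rmul 4 2 0 6 0 2 ;;
  ROp Rmul 4 2 4 2 5 2 ;; ROp Rdiv 4 2 4 2 7 2 ;;
  ROp Rmul 4 2 4 2 5 2 ;; ROp Rdiv 4 2 4 2 7 2 ;;
  ROp Rmul 4 2 4 2 5 2 ;; ROp Rdiv 4 2 4 2 7 2 ;;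
  ROp Rmul 4 2 4 2 5 2 ;; ROp Rdiv 4 2 4 2 7 2 ;;
  ROp Rmul 4 2 4 2 5 2 ;; ROp Rdiv 4 2 4 2 7 2 ;;
  ROp Rdiv 4 2 4 2 13 2 ;; IConst 4 0 ;;
  While (TLt 4 3) (RCopy 18 4 1 4 ;; ISucc 4) ;;
  ICopy 16 0 ;; ICopy 18 1 ;; RCopy 16 2 0 2 ;; RCopy 16 6 4 2.

Lemma halts_prep_prog n d a b (z : seq R) (m : mem) :
  m.1 0%N = n -> m.1 1%N = d -> m.1 2%N = 0%N -> m.1 3%N = (n * d)%N ->
  (forall x, (16 <= x)%N -> m.1 x = 0%N) ->
  m.2 0%N =1 nth 0 [:: a; b] -> m.2 1%N =1 nth 0 z ->
  (forall x k, (2 <= x)%N -> m.2 x k = 0) -> size z = (n * d)%N ->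
  halts (n * d * 4 + 45) (fun m' => [/\ m'.1 0%N = n, m'.1 1%N = d, m'.1 2%N = 0%N,
    proj false m' = imem n d a (alphaR a b) z &
    [/\ m'.2 1%N =1 nth 0 z, m'.2 4%N 0%N = alphaR a b, m'.2 8%N 0%N = 1 &
     forall x k, x \in [:: 2; 9; 10; 12]%N -> m'.2 x k = 0]]) [:: prep_prog] m.
Proof.
case: m => rg ar /= r0 r1 r2 r3 r16 a0 a1 aoth sz.
have -> : (n * d * 4 + 45 =
  (n * d * 4 + 8).+4.+4.+4.+4.+4.+4.+4.+4.+4.+1)%N by lia.
rewrite /prep_prog; straight.
apply: (halts_loop (I := fun i m' => [/\ m'.1 4%N = i, m'.1 6%N = 1%N,
   (forall x, x \notin [:: 4; 6]%N -> m'.1 x = rg x),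
   m'.2 4%N 0%N = alphaR a b &
   [/\ m'.2 8%N 0%N = 1,
   (forall c k, c \notin [:: 4; 5; 7; 8; 13; 18]%N -> m'.2 c k = ar c k) &
   (forall k, m'.2 18%N k = if (k < i)%N then nth 0 z k else 0)]])).
- by move=> i m' [/= -> _ /(_ 3%N)->//]; rewrite r3.
- move=> i [rg' ar'] iN /= [r4 r6 oth A4 [A8 aoth' a18]].
  straight; apply: halts_done; split => //=; try by cells.
  + by rewrite /upd /= r4.
  + move=> x xN; rewrite /upd -oth//; move: xN; rewrite !inE negb_or.
    by case/andP => /negbTE->.
  + split=> [|c k|k]; first by cells.
    * rewrite !inE !negb_or => cN; cells; rewrite -aoth' ?inE ?negb_or//.
      by case/and5P: cN => _ _ _ _ /andP[_ /negbTE->].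
    * cells; rewrite r4 a18 ltnS (leq_eqVlt k i).
      by case: eqP => [->|_] //; rewrite aoth'.
- split => //=.
  + move=> x xN; rewrite /upd; move: xN; rewrite !inE negb_or.
    by case/andP => /negbTE-> /negbTE->.
  + by cells_at r2; rewrite !a0 /alphaR /=.
  + split=> [|c k|k]; [by cells_at r2| |by cells_at r2; rewrite aoth].
    rewrite !inE !negb_or => cN.
    case/and5P: cN => /negbTE n4 /negbTE n5 /negbTE n7 /negbTE n8 /andP[/negbTE n13 _].
    by cells_at (n4, n5, n7, n8, n13).
- move=> [rg' ar'] /= [r4 r6 oth A4 [A8 aoth' a18]].
  have r2' : rg' 2%N = 0%N by rewrite oth.
  have a0' k : ar' 0%N k = nth 0 [:: a; b] k by rewrite aoth'.
  straight; apply: halts_done.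
  split => //=; try by rewrite /upd /= ?r0 oth.
  + rewrite /proj /imem /=; congr pair; apply/funext => -[|[|x]] //=.
    * by rewrite /upd /= oth.
    * by rewrite /upd /= oth.
    * rewrite /upd; do ![rewrite ifN; last by rewrite /place; lia].
      rewrite nth_nil oth; last by rewrite /place !inE; lia.
      by rewrite r16// /place; lia.
    * apply/funext => k; cells; rewrite r2' r6 A4 !a0'.
      by case: k => [|[|k]] //=; rewrite aoth'// aoth// nth_nil.
    * apply/funext => k; cells; rewrite a18.
      by case: ltnP => // kN; rewrite !nth_default ?sz.
    * apply/funext => k; cells.
      do ![rewrite ifN; last by rewrite negb_and /place; apply/orP; left; lia].
      rewrite !nth_nil aoth'; last by rewrite /place !inE; lia.
      by rewrite aoth// /place; lia.
  + split => //=.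
    * by move=> k; cells; rewrite aoth'.
    * by cells.
    * by cells.
    * by move=> x k; rewrite !inE => /or4P[] /eqP ->; cells; rewrite aoth' // aoth.
Qed.

(** The real number n is accumulated in array 9, because a register cannot be turned into a real.
    Register 7 runs through the data in row-major order; array 10 collects the column sums, array 12
    the squared distance, and array 20 is the estimate. *)
Definition far_prog : cmd :=
  IConst 4 0 ;; IConst 7 0 ;;
  While (TLt 4 0) (ROp Radd 9 2 9 2 8 2 ;; IConst 5 0 ;;
    While (TLt 5 1) (ROp Radd 10 5 10 5 1 7 ;; ISucc 5 ;; ISucc 7) ;; ISucc 4) ;;
  IConst 5 0 ;;
  While (TLt 5 1) (ROp Rdiv 11 2 10 5 9 2 ;; ROp Rsub 11 2 20 5 11 2 ;;
    ROp Rmul 11 2 11 2 11 2 ;; ROp Radd 12 2 12 2 11 2 ;; ISucc 5) ;;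
  ROp Rmul 4 2 4 2 4 2 ;;
  If (TRle 12 2 4 2) (IConst 15 0) (RConst 2 2 1).

Lemma halts_far_prog n d al (z : seq R) (m : mem) :
  m.1 0%N = n -> m.1 1%N = d -> m.1 2%N = 0%N ->
  m.2 1%N =1 nth 0 z -> m.2 4%N 0%N = al -> m.2 8%N 0%N = 1 ->
  (forall x k, x \in [:: 2; 9; 10; 12]%N -> m.2 x k = 0) ->
  halts (n * (d * 6 + 2).+4.+2 + (d * 10 + 5).+4).+4.+1
    (fun m' => accb m' = (far n d al z (m.2 20%N))%:R%:E) [:: far_prog] m.
Proof.
case: m => rg ar /= r0 r1 r2 a1 a4 a8 a0.
pose S n' k := \sum_(i < n') nth 0 z (i * d + k).
rewrite /far_prog; straight.
apply: (halts_loop (I := fun i m' => [/\ m'.1 4%N = i, m'.1 7%N = (i * d)%N,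
   (forall x, x \notin [:: 4; 5; 7]%N -> m'.1 x = rg x),
   m'.2 9%N 0%N = i%:R &
   (forall k, (k < d)%N -> m'.2 10%N k = S i k) /\
   (forall c k, c \notin [:: 9; 10]%N -> m'.2 c k = ar c k)])).
- by move=> i m' [/= -> _ /(_ 0%N)->//]; rewrite r0.
- move=> i [rg' ar'] iN /= [r4 r7 oth A9 [A10 aoth]]; straight.
  apply: (halts_loop (I := fun j m' => [/\ m'.1 4%N = i, m'.1 5%N = j,
    m'.1 7%N = (i * d + j)%N,
   (forall x, x \notin [:: 4; 5; 7]%N -> m'.1 x = rg x) &
   [/\ m'.2 9%N 0%N = i.+1%:R,
   (forall k, (k < d)%N -> m'.2 10%N k = S (i + (k < j))%N k) &
   (forall c k, c \notin [:: 9; 10]%N -> m'.2 c k = ar c k)]])).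
  + by move=> j m' [/= _ -> _ /(_ 1%N)->//]; rewrite r1.
  + move=> j [rg2 ar2] jd /= [q4 q5 q7 oth2 [B9 B10 aoth2]]; straight.
    apply: halts_done; split => //=; rewrite /upd /= ?q5 ?q7 ?addnS//.
    * move=> x xN; rewrite -oth2//; move: xN; rewrite !inE !negb_or.
      by case/and3P => _ /negbTE-> /negbTE->.
    * split=> [|k kd|c k]; cells => //.
      - rewrite q5 q7 B10// aoth2// a1 ltnS (leq_eqVlt k j).
        case: eqP => [->|_]; last by rewrite B10.
        by rewrite ltnn addn0 addn1 /S big_ord_recr.
      - rewrite !inE negb_or => cN; rewrite -aoth2 ?inE ?negb_or//.
        by case/andP: cN => _ /negbTE->.
  + split => //=; rewrite /upd /= ?addn0//.
    * move=> x xN; rewrite -oth//; move: xN; rewrite !inE !negb_or.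
      by case/and3P => _ /negbTE->.
    * have r2' : rg' 2%N = 0%N by rewrite oth.
      split=> [|k kd|c k]; cells => //.
      - by rewrite r2' /= A9 aoth// a8 natr1.
      - by rewrite A10.
      - rewrite !inE negb_or => cN; rewrite -aoth ?inE ?negb_or//.
        by case/andP: cN => /negbTE->.
  + move=> [rg2 ar2] /= [q4 q5 q7 oth2 [B9 B10 aoth2]]; straight.
    apply: halts_done; split => //=; rewrite /upd /= ?q4 ?q7 ?mulSn ?(addnC d)//.
    * move=> x xN; rewrite -oth2//; move: xN; rewrite !inE !negb_or.
      by case/and3P => /negbTE->.
    * by split=> // k kd; rewrite B10// kd addn1.
- split => //=; rewrite /upd /= ?mul0n//.
  + move=> x xN; move: xN; rewrite !inE !negb_or.
    by case/and3P => /negbTE-> _ /negbTE->.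
  + by rewrite a0.
  + by split=> // k _; rewrite a0// /S big_ord0.
move=> [rg1 ar1] /= [p4 p7 oth1 C9 [C10 aoth1]]; straight.
apply: (halts_loop (I := fun j m' => [/\ m'.1 5%N = j,
   (forall x, x \notin [:: 4; 5; 7]%N -> m'.1 x = rg x),
   m'.2 9%N 0%N = n%:R,
   m'.2 12%N 0%N = \sum_(j' < j) (ar 20%N j' - S n j' / n%:R) ^+ 2 &
   (forall k, (k < d)%N -> m'.2 10%N k = S n k) /\
   (forall c k, c \notin [:: 9; 10; 11; 12]%N -> m'.2 c k = ar c k)])).
- by move=> j m' [/= -> /(_ 1%N)->//]; rewrite r1.
- move=> j [rg2 ar2] jd /= [q5 oth2 B9 B12 [B10 aoth2]]; straight.
  have q2 : rg2 2%N = 0%N by rewrite oth2.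
  apply: halts_done; split => //=.
  + by rewrite /upd /= q5.
  + move=> x xN; rewrite /upd -oth2//; move: xN; rewrite !inE !negb_or.
    by case/and3P => _ /negbTE->.
  + by cells.
  + cells; rewrite q2 /= q5 B12 B10// B9 aoth2// big_ord_recr /=.
    by rewrite expr2.
  + split=> [k kd|c k]; cells; first by rewrite B10.
    rewrite !inE !negb_or => cN; rewrite -aoth2 ?inE ?negb_or//.
    by case/and4P: cN => _ _ /negbTE-> /negbTE->.
- split => //=.
  + move=> x xN; rewrite /upd -oth1//; move: xN; rewrite !inE !negb_or.
    by case/and3P => _ /negbTE->.
  + by rewrite aoth1// a0// big_ord0.
  + split=> // c k; rewrite !inE !negb_or => /and4P[c9 c10 _ _].
    by rewrite aoth1// !inE negb_or c9.
move=> [rg2 ar2] /= [q5 oth2 B9 B12 [B10 aoth2]]; straight.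
have q2 : rg2 2%N = 0%N by rewrite oth2.
apply: halts_If; rewrite /test_val /=.
match goal with E : forall e i, _ = (if _ then rop_eval Rmul _ _ else _) |- _ =>
  rewrite !E /= q2 /= B12 aoth2// a4 end.
rewrite leNgt -/(far n d al z (ar 20%N)).
have a2' : ar2 2%N 0%N = 0 by rewrite aoth2// a0.
case: (far n d al z (ar 20%N)) => /=; straight; apply: halts_done.
  by rewrite /accb /=; cells; rewrite q2 /= ltr01.
by rewrite /accb /=; cells; rewrite a2' ltxx.
Qed.

Definition base (p : cmd) : cmd :=
  size_prog ;; prep_prog ;; ren false p ;; far_prog.

Lemma wp_base p k n d (a b : R) z : hwithin R p k -> size z = (n * d)%N ->
  wp (time_bound (k + 7 + 5) n d) (@accb R) [:: base p] (imem n d a b z)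
    (V (time_bound k n d)
      (fun m1 => (far n d (alphaR a b) z (m1.2 2%N))%:R%:E) [:: p]
      (imem n d a (alphaR a b) z)).
Proof.
move=> Hp sz.
apply: (wp_weaken (T := ((n * (d * 4 + 2).+4 + 1) + ((n * d * 4 + 45) +
  (time_bound k n d +
   ((n * (d * 6 + 2).+4.+2 + (d * 10 + 5).+4).+4.+1 + 0)).+1).+1).+1)).
  apply: time_bound_ge; rewrite /time_bound.
  by move: ((n + d + 2) ^ k)%N => x; lia.
apply: wp_Seq; apply: wp_det.
  exact: (halts_size_prog (n := n) (d := d)).
move=> m1 [ar1 r13 oth1]; apply: wp_Seq; apply: wp_det.
  apply: (halts_prep_prog (n := n) (d := d) (a := a) (b := b) (z := z)) => //.
  - by rewrite oth1.
  - by rewrite oth1.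
  - by rewrite oth1.
  - move=> x x16; rewrite oth1; last by rewrite !inE; lia.
    by case: x x16 => [|[|x]]//= _; rewrite nth_nil.
  - by move=> i; rewrite ar1.
  - by move=> i; rewrite ar1.
  - by move=> [|[|x]] i //= _; rewrite ar1 /= nth_nil nth_nil.
move=> m2 [r0 r1 r2 P [a1 a4 a8 a0]].
apply: wp_Seq; rewrite -P; apply: wp_ren; first by rewrite P; exact: Hp.
move=> m3.
have a0' x k' : x \in [:: 2; 9; 10; 12]%N -> (merge false m3 m2).2 x k' = 0.
  move=> xin; rewrite /merge /= unplace_small; first exact: a0.
  by move: xin; rewrite !inE; lia.
apply: wp_det.
  exact: (@halts_far_prog n d (alphaR a b) z (merge false m3 m2)
    r0 r1 r2 a1 a4 a8 a0').
by move=> m4 /= <-; exact: wp_done.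
Qed.

Lemma hwithin_base p k : hwithin R p k -> hwithin R (base p) (k + 7 + 5).
Proof. by move=> Hp n d a b z sz; case: (wp_base a b Hp sz). Qed.

Lemma acc_base p k n d (a b : R) z : hwithin R p k -> size z = (n * d)%N ->
  acc (base p) (k + 7 + 5) n d a b z =
  V (time_bound k n d)
    (fun m1 => (far n d (alphaR a b) z (m1.2 2%N))%:R%:E) [:: p]
    (imem n d a (alphaR a b) z).
Proof. by move=> Hp sz; have [] := wp_base a b Hp sz. Qed.

End base_program.

(** * A lower bound for binomial probabilities *)

Section binomial.
Context (R : realType).
Implicit Types (p : R) (f : nat -> R).

(** The expectation of f(K) for a binomial K, by recursion on the first label: a success replaces f
    by its shift. The moments below carry an offset [c] that absorbs this shift. *)
Fixpoint ebin p n f : R :=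
  if n is n'.+1 then (1 - p) * ebin p n' f + p * ebin p n' (fun k => f k.+1)
  else f 0%N.

Lemma Bin_ebin p n f :
  Bin p n (fun b => (f (count id b))%:E) = (ebin p n f)%:E.
Proof.
elim: n f => //= n ih f.
by rewrite (ih f) (ih (fun k => f k.+1)) -!EFinM -EFinD.
Qed.

Lemma le_ebin p n f g : 0 <= p <= 1 -> (forall k, f k <= g k) ->
  ebin p n f <= ebin p n g.
Proof.
move=> /andP[p0 p1]; elim: n f g => //= n ih f g fg.
by rewrite lerD// ler_wpM2l ?subr_ge0// ih.
Qed.

Lemma ebin_lin p n (a b c : R) f1 f2 f3 :
  ebin p n (fun k => a * f1 k + b * f2 k + c * f3 k) =
  a * ebin p n f1 + b * ebin p n f2 + c * ebin p n f3.
Proof.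
elim: n f1 f2 f3 => //= n ih f1 f2 f3; rewrite ih.
by rewrite (ih (fun k => f1 k.+1) (fun k => f2 k.+1) (fun k => f3 k.+1)); ring.
Qed.

Lemma eq_ebin p n f g : f =1 g -> ebin p n f = ebin p n g.
Proof. by move=> /funext ->. Qed.

Lemma ebin_mom1 p n c : ebin p n (fun k => k%:R + c) = n%:R * p + c.
Proof.
elim: n c => /= [|n ih] c; first by ring.
rewrite ih (@eq_ebin _ _ _ (fun k => k%:R + (1 + c))); last first.
  by move=> k; rewrite -natr1; ring.
by rewrite ih -natr1; ring.
Qed.

Lemma ebin_mom2 p n c : ebin p n (fun k => (k%:R + c) ^+ 2) =
  (n%:R * p + c) ^+ 2 + n%:R * p * (1 - p).
Proof.
elim: n c => /= [|n ih] c; first by ring.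
rewrite ih (@eq_ebin _ _ _ (fun k => (k%:R + (1 + c)) ^+ 2)); last first.
  by move=> k; rewrite -natr1; ring.
by rewrite ih -natr1; ring.
Qed.

(** At c = - n p the variable x vanishes, and what remains is the fourth central moment. *)
Lemma ebin_mom4 p n c : ebin p n (fun k => (k%:R + c) ^+ 4) =
  let x := n%:R * p + c in let v := n%:R * p * (1 - p) in
  x ^+ 4 + 6 * x ^+ 2 * v + 4 * x * (v * (1 - 2 * p)) +
  3 * v ^+ 2 + v * (1 - 6 * p * (1 - p)).
Proof.
elim: n c => /= [|n ih] c; first by ring.
rewrite ih (@eq_ebin _ _ _ (fun k => (k%:R + (1 + c)) ^+ 4)); last first.
  by move=> k; rewrite -natr1; ring.
by rewrite ih /= -natr1; ring.
Qed.

Lemma ebin_eq0 p n : ebin p n (fun k => (k == 0%N)%:R) = (1 - p) ^+ n.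
Proof.
elim: n => [|n ih] /=; first by rewrite expr0.
rewrite ih (@eq_ebin _ _ _ (fun k => 0 * 0 + 0 * 0 + 0 * 0)); last first.
  by move=> k /=; rewrite !mul0r !addr0.
by rewrite ebin_lin exprS; ring.
Qed.

(** The exact probability has exponent n - 1; the exponent n loses a factor 1 - p and keeps the
    induction free of predecessors. *)
Lemma ebin_eq1 p n : 0 <= p <= 1 ->
  n%:R * p * (1 - p) ^+ n <= ebin p n (fun k => (k == 1%N)%:R).
Proof.
move=> /andP[p0 p1]; have q0 : 0 <= 1 - p by rewrite subr_ge0.
elim: n => [|n ih] /=; first by rewrite !mul0r.
have -> : ebin p n (fun k => (k.+1 == 1%N)%:R) = (1 - p) ^+ n.
  by rewrite -ebin_eq0; exact: eq_ebin.
apply: (@le_trans _ _ ((1 - p) * (n%:R * p * (1 - p) ^+ n) + p * (1 - p) ^+ n)).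
  have qn : 0 <= (1 - p) ^+ n by exact: exprn_ge0.
  rewrite exprS -natr1; move: (_ ^+ n) qn => y y0.
  have : 0 <= p * p * y by rewrite !mulr_ge0.
  by nra.
by rewrite lerD2r ler_wpM2l.
Qed.

Definition good p n k : bool := (n%:R * p <= 10 * k%:R) && (k%:R <= n%:R * p).

(** For p <= 1/3 one has (1 - p) (1 + 3 p / 2) >= 1, so 1 - p >= exp (- 3 p / 2) and the power is at
    least exp (- 15); then exp (- 1/2) >= 1/2 gives the exponent 30. *)
Lemma pow_lower p n : 0 <= p <= 1 / 3 -> n%:R * p <= 10 ->
  (1 / 2) ^+ 30 <= (1 - p) ^+ n.
Proof.
move=> /andP[p0 p3] np.
have e1 (x : R) : 1 - x <= expR (- x) by rewrite expR_ge1Dx.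
have h : expR (- (3 / 2 * p)) <= 1 - p.
  have pos : 0 < 1 + 3 / 2 * p by rewrite ltr_wpDr// mulr_ge0//; lra.
  rewrite expRN; apply: (@le_trans _ _ (1 + 3 / 2 * p)^-1).
    by rewrite lef_pV2 ?posrE ?expR_gt0// expR_ge1Dx.
  by rewrite -[leLHS]mul1r ler_pdivrMr//; nra.
apply: (@le_trans _ _ (expR (- (3 / 2 * p)) ^+ n)); last first.
  by rewrite lerXn2r// nnegrE ?expR_ge0//; lra.
rewrite -expRM_natl.
apply: (@le_trans _ _ (expR (30%:R * - (1 / 2)))).
  have eh : 1 / 2 <= expR (- (1 / 2)) :> R by have := e1 (1 / 2); lra.
  by rewrite expRM_natl lerXn2r ?nnegrE ?expR_ge0//; lra.
by rewrite ler_expR; lra.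
Qed.

(* The quartic -y + y^2 - (7/40) y^4 in the standardized variable y is
   negative for y > 0 and for y^2 > 8.1, and at most 4 elsewhere. *)
Lemma test_quartic (y : R) :
  - y + y ^+ 2 - 7 / 40 * y ^+ 4 <= 4 * ((y <= 0) && (y ^+ 2 <= 81 / 10))%:R.
Proof.
have [y0|y0] := leP y 0; last first.
  rewrite mulr0 (_ : _ - _ = - (y * (1 - y + 7 / 40 * y ^+ 3))); last by ring.
  rewrite oppr_le0 mulr_ge0 ?ltW//.
  (* This is the tangent bound for y^3 at 7/5, close to the minimum of the cubic. *)
  have : 0 <= (y - 7 / 5) ^+ 2 * (y + 14 / 5) by rewrite mulr_ge0 ?sqr_ge0//; lra.
  by nra.
have [ys|ys] := leP (y ^+ 2) (81 / 10).
  (* Completing the square in y^2 at 4 and then in y at - 5/4 bounds the quartic by 3.425. *)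
  rewrite mulr1; have h1 : 0 <= (y ^+ 2 - 4) ^+ 2 by exact: sqr_ge0.
  have h2 : 0 <= (y + 5 / 4) ^+ 2 by exact: sqr_ge0.
  by nra.
rewrite mulr0; have y14 : 14 / 5 <= - y by nra.
have h : 0 <= (- y) * ((- y) * (y ^+ 2 - 81 / 10)).
  by rewrite !mulr_ge0//; lra.
have h' : 0 <= (- y) * ((- y) - 14 / 5) by rewrite mulr_ge0//; lra.
by nra.
Qed.

(** A fourth-moment argument in y = (k - n p) / s. The quartic has mean 1 - 7/40 (3 + (1 - 6 p (1 -
    p)) / v), at least 4/10 because v >= 20/3, and it is at most 4 times the indicator of a good
    count. Its linear term, of mean 0, is what selects the side y <= 0. *)
Lemma good_lower_large p n : 0 <= p <= 1 / 3 -> 10 <= n%:R * p ->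
  1 / 10 <= ebin p n (fun k => (good p n k)%:R).
Proof.
move=> /andP[p0 p3] np; pose v := n%:R * p * (1 - p).
have v6 : 20 / 3 <= v by rewrite /v; nra.
have vnp : v <= n%:R * p by rewrite /v; nra.
have v0 : 0 < v by lra.
pose s := Num.sqrt v; have s0 : 0 < s by rewrite sqrtr_gt0.
have sv : s ^+ 2 = v by rewrite sqr_sqrtr// ltW.
have sn0 : s != 0 by rewrite gt_eqF.
have vn0 : v != 0 by rewrite gt_eqF.
pose y k := (k%:R - n%:R * p) / s.
(* From v <= n p and n p >= 10 follows 81/10 v <= (9/10 n p)^2, so y^2 <= 81/10 leaves k >= n p /
   10. *)
have yg k : ((y k <= 0) && (y k ^+ 2 <= 81 / 10) -> good p n k)%R.
  move=> /andP[yk0 yk2].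
  have k1 : k%:R <= n%:R * p.
    by rewrite -subr_le0; move: yk0; rewrite /y pmulr_lle0// invr_gt0.
  rewrite /good k1 andbT leNgt; apply/negP => k2.
  move: yk2; rewrite /y exprMn exprVn sv ler_pdivrMr// => yk2.
  by nra.
have ty k : - y k + y k ^+ 2 - 7 / 40 * y k ^+ 4 <= 4 * (good p n k)%:R.
  apply: le_trans (test_quartic _) _; rewrite ler_wpM2l// ler_nat.
  by case E : (_ && _) => //; rewrite yg.
have p01 : 0 <= p <= 1 by apply/andP; split => //; lra.
have := le_ebin n p01 ty.
rewrite (@eq_ebin _ _ (fun k => 4 * (good p n k)%:R)
  (fun k => 4 * (good p n k)%:R + 0 * 0 + 0 * 0)); last first.
  by move=> k; rewrite !mul0r !addr0.
rewrite (ebin_lin _ _ _ _ _ _ (fun=> 0) (fun=> 0)) !mul0r !addr0.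
rewrite (@eq_ebin _ _ _ (fun k => (- s^-1) * (k%:R + - (n%:R * p)) +
  v^-1 * (k%:R + - (n%:R * p)) ^+ 2 +
  (- (7 / 40) * v^-1 ^+ 2) * (k%:R + - (n%:R * p)) ^+ 4)); last first.
  by move=> k; rewrite /y -sv; field; rewrite ?sn0.
rewrite ebin_lin ebin_mom1 ebin_mom2 ebin_mom4 /= subrr -/v.
set E := ebin _ _ _.
rewrite (_ : _ + _ = 1 - 7 / 40 * (3 + v^-1 * (1 - 6 * p * (1 - p)))); last first.
  by field; rewrite ?vn0.
have vi : v^-1 <= 3 / 20.
  by rewrite -[leRHS]invrK lef_pV2 ?posrE ?invr_gt0//; lra.
have vi0 : 0 < v^-1 by rewrite invr_gt0.
have pq : 0 <= p * (1 - p) by rewrite mulr_ge0//; lra.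
have : v^-1 * (1 - 6 * p * (1 - p)) <= 3 / 20 by nra.
by lra.
Qed.

(** For n p <= 10 a single label suffices: the count 1 is good because 1 <= n p <= 10, and its
    probability is at least n p (1 - p)^n. For larger n p the fourth-moment bound is far
    stronger. *)
Lemma good_lower p n : 0 <= p <= 1 / 3 -> 1 <= p * n%:R ->
  (1 / 2) ^+ 30 <= ebin p n (fun k => (good p n k)%:R).
Proof.
move=> p3 np1; have /andP[p0 p13] := p3.
have p01 : 0 <= p <= 1 by apply/andP; split => //; lra.
have [np|np] := leP (n%:R * p) 10; last first.
  apply: le_trans (good_lower_large p3 (ltW np)).
  have h (k : nat) : (1 / 2 : R) ^+ k <= 1 by rewrite exprn_ile1//; lra.
  by rewrite (_ : 30 = 4 + 26)%N// exprD; have := h 26; nra.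
apply: (@le_trans _ _ (ebin p n (fun k => (k == 1%N)%:R))); last first.
  apply: le_ebin => // k; rewrite ler_nat; case: eqP => // ->.
  by rewrite /good mulr1 np mulrC np1.
apply: le_trans (ebin_eq1 _ p01); apply: (le_trans (pow_lower p3 np)).
rewrite ler_peMl//; first by rewrite exprn_ge0//; lra.
by rewrite mulrC.
Qed.

End binomial.

(** * Programs run on random data *)

Section program_probabilities.
Context (R : realType).
Notation mem := ((nat -> nat) * (nat -> nat -> R))%type.
Local Open Scope ereal_scope.

Lemma tape_prob T N (c : mem -> bool) l m : (T <= N)%N ->
  mmem (fun m => (c m)%:R%:E : \bar R) ->
  tape_law R N [set u | c (final T l m (nth 0%R (val u)))] =
  V T (fun m => (c m)%:R%:E) l m.
Proof.
move=> TN mc; have c0 m' : 0 <= (c m')%:R%:E :> \bar R by rewrite lee_fin.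
rewrite -(integral_tape_law l m TN mc c0).
set E := [set u | _].
have mu : mfam (fun u : N.-tuple (measurableTypeR R) => val u).
  exact: (mfam_tuple (@measurable_id _ _ _)).
have mE : measurable E.
  have mf : measurable_fun setT (fun u : N.-tuple (measurableTypeR R) =>
      (c (final T l m (nth 0%R (val u))))%:R%:E : \bar R).
    case: m {E} => rg ar; apply: (measurable_final T l rg (ar := fun=> ar) mc).
      by move=> a i; exact: measurable_cst.
    by case: mu.
  have := mf measurableT _ (@emeasurable_set1 R 1); rewrite setTI.
  congr measurable; apply/seteqP; split=> u /=.
    by rewrite /E /=; case: (c _) => //= /eqP; rewrite eqe eq_sym oner_eq0.
  by rewrite /E /= => ->.
transitivity (\int[tape_law R N]_u (\1_E u)%:E).
  by rewrite integral_indic// setIT.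
apply: eq_integral => u _; rewrite indicE.
have -> // : (u \in E) = c (final T l m (nth 0%R (val u))).
by apply/idP/idP => [/set_mem|cu]; [|exact: mem_set].
Qed.

Lemma prod_tape_prob dsp (W : measurableType dsp) (Q : probability W R) T N
    (c : W -> mem -> bool) l (m : W -> mem) : (T <= N)%N ->
  (forall w, mmem (fun m => (c w m)%:R%:E : \bar R)) ->
  (Q \x tape_law R N) [set z | c z.1 (final T l (m z.1) (nth 0%R (val z.2)))] =
  \int[Q]_w V T (fun m => (c w m)%:R%:E) l (m w).
Proof.
move=> TN mc; rewrite /product_measure1; apply: eq_integral => w _.
by rewrite -(tape_prob l (m w) TN (mc w)) /= xsectionE.
Qed.

Lemma mmem_bool (c : mem -> bool) :
  (forall dsp (W : measurableType dsp) rg (ar : W -> nat -> nat -> R),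
    mfamm ar -> measurable_fun setT (fun w => c (rg, ar w))) ->
  mmem (fun m => (c m)%:R%:E : \bar R).
Proof.
move=> mc dsp W rg ar mar.
have -> : (fun w => (c (rg, ar w))%:R%:E) =
    (fun w => if c (rg, ar w) then 1 else 0) :> (W -> \bar R).
  by apply/funext => w; case: (c _).
by apply: measurable_fun_ifT => //; exact: mc.
Qed.

Lemma prod_accept n d (Q : probability (samples R n d) R) p k (a b : R) :
  (Q \x tape_law R (time_bound k n d)) (@accepted R p k n d a b) =
  \int[Q]_X acc p k n d a b (flat X).
Proof.
apply: (prod_tape_prob (c := fun _ m => (0 < m.2 2%N 0%N)%R) _ _
  (fun X : samples R n d => imem n d a b (flat X))) => // _.
apply: mmem_bool => dsp W rg ar mar.
by apply: measurable_fun_ltr => //; exact: mar.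
Qed.

Lemma measurable_far dsp (W : measurableType dsp) n d (al : R) (z : W -> seq R)
    (e : W -> nat -> R) : mfam z -> (forall j, measurable_fun setT (fun w => e w j)) ->
  measurable_fun setT (fun w => far n d al (z w) (e w)).
Proof.
move=> [_ mz] me; apply: measurable_fun_ltr; first exact: measurable_cst.
apply: measurable_sum => j; apply: measurable_funX; apply: measurable_funB => //.
by apply: measurable_funM => //; apply: measurable_sum => i.
Qed.

Lemma mmem_far n d al z b :
  mmem (fun m : mem => (b (+) far n d al z (m.2 2%N))%:R%:E : \bar R).
Proof.
apply: mmem_bool => dsp W rg ar mar.
have mf : measurable_fun setT (fun w => far n d al z (ar w 2%N)).
  by apply: measurable_far => [|j]; [exact: mfam_cst|exact: mar].
by case: b => //=; exact: measurable_neg.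
Qed.

Lemma edist_far p k n d (a al : R) (X Y : samples R n d) u : (0 < al)%R ->
  (Defs.edist (@estimate R p k n d a al Y u) (emp_mean X) <= al)%R =
  ~~ far n d al (flat X) (@output R p k n d a al Y u).
Proof.
move=> al0; rewrite /far -leNgt /Defs.edist /enorm.
rewrite -[X in (_ <= X)%R = _]gtr0_norm// -sqrtr_sqr ler_sqrt ?sqr_ge0//.
rewrite expr2; congr (_ <= _)%R; apply: eq_bigr => j _.
rewrite !tnth_mktuple; congr ((_ - _) ^+ 2)%R; rewrite mulrC; congr (_ / _)%R.
by apply: eq_bigr => i _; rewrite nth_flat.
Qed.

(** The adversary adds fixed vectors [S], so the corrupted data are again independent Gaussians with
    known means. *)
Definition shift n d (S X : samples R n d) : samples R n d :=
  [tuple [tuple tnth (tnth X i) j + tnth (tnth S i) j | j < d] | i < n]%R.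

Lemma measurable_shift n d (S : samples R n d) : measurable_fun setT (shift S).
Proof.
apply/measurable_fun_tnthP => i; apply/measurable_fun_tnthP => j.
have -> : (tnth (T:=measurableTypeR R))^~ j \o (((tnth (T:=vect R d))^~ i) \o shift S)
    = (fun X => tnth (tnth X i) j + tnth (tnth S i) j)%R.
  by apply/funext => X /=; rewrite !tnth_mktuple.
apply: measurable_funD; last exact: measurable_cst.
exact: (measurableT_comp (measurable_tnth j) (measurable_tnth i)).
Qed.

Lemma flat_shift n d (S X : samples R n d) :
  flat (shift S X) = lin 1 1 (flat X) (flat S).
Proof.
have sz : size (flat X) = size (flat S) by rewrite !size_flat.
apply: (@eq_from_nth _ 0%R) => [|k]; first by rewrite size_lin// !size_flat.
rewrite size_flat => ltk.
have d0 : (0 < d)%N by case: d ltk {S X sz} => //; rewrite muln0.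
have kn : (k %/ d < n)%N by rewrite ltn_divLR.
have kd : (k %% d < d)%N by rewrite ltn_mod.
have E (Z : samples R n d) : nth 0%R (flat Z) k =
    tnth (tnth Z (Ordinal kn)) (Ordinal kd).
  by rewrite -nth_flat /= -divn_eq.
by rewrite nth_lin// !mul1r !E !tnth_mktuple.
Qed.

(** The probability that the estimator, run on corrupted data [y], is close to the mean of the clean
    data y - c. Expressing the clean data through [y] puts this and the acceptance probability under
    one law. *)
Definition near_shift p k n d (a al : R) (c y : seq R) : \bar R :=
  V (time_bound k n d)
    (fun m : mem => (~~ far n d al (lin 1 (-1) y c) (m.2 2%N))%:R%:E) [:: p]
    (imem n d a al y).

Lemma near_shift_ge0 p k n d (a al : R) c y : 0 <= near_shift p k n d a al c y.
Proof. by apply: V_ge0 => m; rewrite lee_fin. Qed.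

Lemma mseq_near_shift p k n d (a al : R) c :
  mseq (near_shift p k n d a al c).
Proof.
move=> dsp W y my; rewrite /near_shift.
apply: (measurable_V_param _ (h := fun w (m : mem) =>
  (~~ far n d al (lin 1 (-1) (y w) c) (m.2 2%N))%:R%:E)).
- move=> dsp' W' f rg ar mf mar.
  have mb : measurable_fun setT
      (fun w => ~~ far n d al (lin 1 (-1) (y (f w)) c) (ar w 2%N)).
    apply: measurable_neg; apply: measurable_far => [|j]; last exact: mar.
    by apply: mfam_lin; [exact: (mfam_comp mf my)|exact: mfam_cst].
  have -> : (fun w => (~~ far n d al (lin 1 (-1) (y (f w)) c) (ar w 2%N))%:R%:E) =
    (fun w => if ~~ far n d al (lin 1 (-1) (y (f w)) c) (ar w 2%N) then 1 else 0)
    :> (W' -> \bar R) by apply/funext => w; case: (~~ _).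
  exact: measurable_fun_ifT.
- by move=> w m; rewrite lee_fin.
- exact: mfamm_imem.
Qed.

Lemma linK (z c : seq R) : size z = size c -> lin 1 (-1) (lin 1 1 z c) c = z.
Proof.
elim: z c => [|x z ih] [|y c] //= [zc]; rewrite /lin /=; congr (_ :: _).
  by rewrite !mul1r mulN1r addrK.
exact: ih.
Qed.

(** Robustness is applied on the space of clean data itself, with X the identity and Y its shift by
    [S]; translating the means then makes the corrupted data the variable of integration. *)
Lemma robust_Eg p k n d (eta al : R) (mu : vect R d) (S : samples R n d) :
  (0 < al)%R -> robustly_estimates p k n eta al mu ->
  (forall X, (hamming X (shift S X))%:R <= eta * n%:R)%R ->
  (2 / 3)%:E <= Eg (lin 1 1 (flatten (nseq n (val mu))) (flat S))
    (near_shift p k n d eta al (flat S)).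
Proof.
move=> al0 rob ham.
pose P := iid_law (gauss mu) n.
pose idX : {RV P >-> samples R n d} := HB.pack (fun x : samples R n d => x)
  (isMeasurableFun.Build _ _ _ _ (fun x : samples R n d => x) (@measurable_id _ _ _)).
pose Y : {RV P >-> samples R n d} := HB.pack (shift S)
  (isMeasurableFun.Build _ _ _ _ (shift S) (measurable_shift S)).
have := rob _ _ P idX Y (fun A _ => erefl) ham.
have sm : size (flat S) = size (flatten (nseq n (val mu))).
  have := size_flat (nseq_tuple n mu); rewrite /flat /= map_nseq => ->.
  by rewrite size_flat.
rewrite -Eg_translation//; last 2 first.
- exact: mseq_near_shift.
- exact: near_shift_ge0.
rewrite -(@integral_iid_gauss _ n d mu
  (fun z => near_shift p k n d eta al (flat S) (lin 1 1 z (flat S)))); last 2 first.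
- move=> dsp W z mz; apply: mseq_near_shift.
  by apply: mfam_lin => //; exact: mfam_cst.
- by move=> z; exact: near_shift_ge0.
congr (_ <= _).
pose c (X : samples R n d) (m : mem) := ~~ far n d al (flat X) (m.2 2%N).
have -> : [set z : samples R n d * (time_bound k n d).-tuple (measurableTypeR R) |
      (Defs.edist (@estimate R p k n d eta al (Y z.1) z.2) (emp_mean (idX z.1)) <= al)%R] =
    [set z | c z.1 (final (time_bound k n d) [:: p]
      (imem n d eta al (flat (shift S z.1))) (nth 0%R (val z.2)))].
  by apply/seteqP; split=> z /=; rewrite edist_far.
rewrite (prod_tape_prob _ (c := c) _
  (fun X => imem n d eta al (flat (shift S X)))) => [|//|X].
- apply: eq_integral => X _; rewrite /near_shift flat_shift linK//.
  by rewrite !size_flat.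
- exact: (mmem_far n d al (flat X) true).
Qed.

Lemma far_near p n d (a al : R) z T :
  V T (fun m : mem => (far n d al z (m.2 2%N))%:R%:E) [:: p] (imem n d a al z) +
  V T (fun m : mem => (~~ far n d al z (m.2 2%N))%:R%:E) [:: p] (imem n d a al z) = 1
  :> \bar R.
Proof.
rewrite -VD; last 4 first.
- exact: (mmem_far n d al z false).
- exact: (mmem_far n d al z true).
- by move=> m; rewrite lee_fin.
- by move=> m; rewrite lee_fin.
rewrite -[RHS](V_cst T 1 [:: p] (imem n d a al z)).
congr (V _ _ _ _); apply/funext => m; case: far => /=.
  by rewrite adde0.
by rewrite add0e.
Qed.

End program_probabilities.

(** * The reduction *)

Section reduction.
Context (R : realType).
Local Open Scope ereal_scope.

Fixpoint stages (r : nat) (p : cmd) : cmd :=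
  if r is r'.+1 then stage (stages r' p) else p.

Definition stages_time (r k : nat) : nat := iter r (fun k => k + 7 + 5)%N k.

Lemma hwithin_stages r p k : hwithin R p k ->
  hwithin R (stages r p) (stages_time r k).
Proof. by move=> Hp; elim: r => //= r ih; exact: hwithin_stage. Qed.

Lemma hwithin_runs p k : hwithin R p k <-> runs_within R p k.
Proof.
split=> [H n d a b X u|H n d a b z sz].
  exact: (proj2 (halts_tape (time_bound k n d) [:: p] (imem n d a b (flat X)))
    (H n d a b (flat X) (size_flat X)) u).
pose X : samples R n d := [tuple [tuple nth 0%R z (i * d + j) | j < d] | i < n].
have -> : z = flat X.
  apply: (@eq_from_nth _ 0%R) => [|q]; first by rewrite size_flat.
  rewrite sz => ltq.
  have d0 : (0 < d)%N by case: d ltq {X sz} => //; rewrite muln0.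
  have qn : (q %/ d < n)%N by rewrite ltn_divLR.
  have qd : (q %% d < d)%N by rewrite ltn_mod.
  rewrite [q in RHS](divn_eq q d).
  have := nth_flat X (Ordinal qn) (Ordinal qd); rewrite /= => ->.
  by rewrite !tnth_mktuple /= -divn_eq.
by apply/halts_tape => u; exact: (H n d a b X u).
Qed.

(** Null means are 0 and stay 0 under both scalings, so each stage squares the acceptance
    probability. *)
Lemma acc_stages_le r p k n d (a b q : R) : hwithin R p k -> (0 <= q)%R ->
  Eg (nseq (n * d) 0%R) (acc p k n d a b) <= q%:E ->
  Eg (nseq (n * d) 0%R) (acc (stages r p) (stages_time r k) n d a b) <=
  (q ^+ (2 ^ r))%:E.
Proof.
move=> Hp q0 base; elim: r => [|r ih]; first by rewrite expn0 expr1.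
rewrite /= Eg_acc_stage ?size_nseq//; last exact: hwithin_stages.
rewrite !map_nseq !mulr0 expnS mul2n -addnn exprD EFinM.
have E0 : 0 <= Eg (nseq (n * d) 0%R)
    (acc (stages r p) (stages_time r k) n d a b).
  by apply: Eg_ge0 => z; exact: acc_ge0.
exact: lee_pmul.
Qed.

Lemma cosR_gt0 : (0 < cosR R)%R. Proof. by rewrite divr_gt0. Qed.
Lemma sinR_gt0 : (0 < sinR R)%R. Proof. by rewrite divr_gt0. Qed.
Lemma cosR_le_sinR : (cosR R <= sinR R)%R.
Proof. by rewrite ler_pM2r ?invr_gt0// ler_nat. Qed.

(** A stage replaces the scale s of the means by cos s and sin s; since cos <= sin, after r stages
    all scales lie between cos^r s and sin^r s, and the basic test has to be good only there. *)
Lemma acc_stages_ge r p k n d (a b q lo hi : R) ms : hwithin R p k ->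
  (0 <= q)%R -> size ms = (n * d)%N ->
  (forall s, (lo <= s <= hi)%R ->
     q%:E <= Eg [seq s * m | m <- ms]%R (acc p k n d a b)) ->
  forall s, (0 <= s)%R -> (lo <= cosR R ^+ r * s)%R -> (sinR R ^+ r * s <= hi)%R ->
  (q ^+ (2 ^ r))%:E <=
  Eg [seq s * m | m <- ms]%R (acc (stages r p) (stages_time r k) n d a b).
Proof.
move=> Hp q0 sms base; elim: r => [|r ih] s s0 los his.
  rewrite expn0 expr1; apply: base.
  by move: los his; rewrite !expr0 !mul1r => -> ->.
rewrite /= Eg_acc_stage ?size_map//; last exact: hwithin_stages.
rewrite expnS mul2n -addnn exprD EFinM -!map_comp.
have E c : [seq ( *%R c \o *%R s) m | m <- ms] = [seq (c * s) * m | m <- ms]%R.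
  by apply: eq_map => m /=; rewrite mulrA.
rewrite [X in Eg X _ * _](E (cosR R)) [X in _ * Eg X _](E (sinR R)).
have cs : (cosR R * s <= sinR R * s)%R by rewrite ler_wpM2r// cosR_le_sinR.
have c0 : (0 <= cosR R ^+ r)%R by rewrite exprn_ge0// ltW// cosR_gt0.
have d0 : (0 <= sinR R ^+ r)%R by rewrite exprn_ge0// ltW// sinR_gt0.
apply: lee_pmul; rewrite ?lee_fin ?exprn_ge0//; apply: ih.
- by rewrite mulr_ge0// ltW// cosR_gt0.
- by rewrite mulrA -exprSr.
- by apply: le_trans his; rewrite exprSr -mulrA ler_wpM2l.
- by rewrite mulr_ge0// ltW// sinR_gt0.
- by apply: (le_trans los); rewrite exprSr -mulrA ler_wpM2l.
- by rewrite mulrA -exprSr.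
Qed.

(** The constant 21 (169/120)^5: the largest scale after five stages is sin^5, and it yields a clean
    mean of norm exactly 21 alpha. *)
Definition scaleC : R := (iter 5 (fun t => t / (120%:R / 169%:R)) 21%:R)%R.

Lemma alphaR_scaleC (eta al : R) : eta != 0%R ->
  alphaR eta (scaleC * (al / eta)) = al.
Proof.
move=> eta0; rewrite /alphaR /scaleC /=.
set x := (120%:R)%R; set y := (169%:R)%R; set w := (21%:R)%R.
have x0 : x != 0%R :> R by rewrite pnatr_eq0.
have y0 : y != 0%R :> R by rewrite pnatr_eq0.
have w0 : w != 0%R :> R by rewrite pnatr_eq0.
by field; rewrite ?eta0 ?x0 ?y0 ?w0.
Qed.

Lemma enorm_vscale d c (v : vect R d) : enorm (vscale c v) = (`|c| * enorm v)%R.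
Proof.
rewrite /enorm -sqrtr_sqr -sqrtrM ?sqr_ge0//; congr Num.sqrt.
by rewrite mulr_sumr; apply: eq_bigr => i _; rewrite tnth_mktuple exprMn.
Qed.

Definition labelled d (eta delta : R) (v : vect R d) (bs : seq bool) : seq R :=
  flatten [seq (if c then val (vscale ((1 - eta) * delta) v)
                else val (vscale (- (eta * delta)) v)) | c <- bs]%R.

Lemma size_flatten_map (T : Type) (r : T -> seq R) q bs :
  (forall c, size (r c) = q) -> size (flatten (map r bs)) = (size bs * q)%N.
Proof. by move=> rq; elim: bs => //= c bs ih; rewrite size_cat ih mulSn rq. Qed.

Lemma size_labelled d (eta delta : R) (v : vect R d) bs :
  size (labelled eta delta v bs) = (size bs * d)%N.
Proof. by apply: size_flatten_map => -[]; rewrite size_tuple. Qed.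

Lemma lin_cat (a b : R) z1 z2 g1 g2 : size z1 = size g1 ->
  lin a b (z1 ++ z2) (g1 ++ g2) = lin a b z1 g1 ++ lin a b z2 g2.
Proof. by move=> zg; rewrite /lin zip_cat// map_cat. Qed.

Lemma lin_flatten_map (T : Type) (a b : R) (u : seq R) (g : T -> seq R) bs :
  (forall c, size (g c) = size u) ->
  lin a b (flatten (nseq (size bs) u)) (flatten (map g bs)) =
  flatten [seq lin a b u (g c) | c <- bs].
Proof. by move=> gu; elim: bs => //= c bs ih; rewrite lin_cat ?ih ?gu. Qed.

(** The two centers differ by delta v, so scaled planted means are those of clean data of label
    [false], with s delta v added at the samples of label [true]. *)
Lemma labelled_shift d (eta delta s : R) (v : vect R d) (bs : seq bool) :
  lin 1 1 (flatten (nseq (size bs) (val (vscale (- (s * (eta * delta))) v))))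
    (flatten [seq val (vscale (if c then s * delta else 0) v) | c <- bs]%R) =
  [seq s * m | m <- labelled eta delta v bs]%R.
Proof.
rewrite lin_flatten_map => [|c]; last by rewrite !size_tuple.
rewrite /labelled map_flatten -map_comp; congr flatten; apply: eq_map => c.
have nE e i (id : (i < d)%N) :
    nth 0%R (val (vscale e v)) i = (e * tnth v (Ordinal id))%R.
  by rewrite -[i]/(nat_of_ord (Ordinal id)) -tnth_nth tnth_mktuple.
apply: (@eq_from_nth _ 0%R) => [|i].
  by rewrite size_lin ?size_tuple// size_map; case: c; rewrite size_tuple.
rewrite size_lin ?size_tuple// => id; rewrite nth_lin ?size_tuple//.
rewrite [RHS](nth_map 0%R); last by case: c; rewrite size_tuple.
by case: c; rewrite !(nE _ _ id); ring.
Qed.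

Lemma count_sum n (bs : n.-tuple bool) :
  (\sum_(i < n) (tnth bs i)%:R = (count id bs)%:R :> R)%R.
Proof.
rewrite -(big_tuple _ _ bs xpredT (fun b : bool => b%:R%R)).
by elim: (tval bs) => [|b s ih] /=; rewrite ?big_nil// big_cons ih natrD.
Qed.

(** An estimate within al of both empirical means would put them at distance at most 2 al, but they
    are t > 2 al apart. The inequality [key] is a squared triangle inequality, used coordinate by
    coordinate. *)
Lemma far_shift n d (al t : R) (v : vect R d) (y c : seq R) (e : nat -> R) :
  size y = size c -> (0 < al)%R -> (2 * al < t)%R -> enorm v = 1%R ->
  (forall j : 'I_d, ((\sum_(i < n) nth 0 c (i * d + j)) / n%:R = t * tnth v j)%R) ->
  ~~ far n d al (lin 1 (-1) y c) e -> far n d al y e.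
Proof.
move=> yc al0 tal v1 ct; rewrite /far -leNgt => near; rewrite ltNge.
apply/negP => near'.
have v2 : (\sum_(j < d) tnth v j ^+ 2 = 1)%R.
  have S0 : (0 <= \sum_(j < d) tnth v j ^+ 2)%R by apply: sumr_ge0 => j _; exact: sqr_ge0.
  by rewrite -(sqr_sqrtr S0) -/(enorm v) v1 expr1n.
have key (x u w : R) : (w ^+ 2 <= 2 * (x - (u - w)) ^+ 2 + 2 * (x - u) ^+ 2)%R.
  rewrite -subr_ge0 (_ : _ - _ = (x - (u - w) + (x - u)) ^+ 2)%R ?sqr_ge0//.
  by ring.
have : (t ^+ 2 <= 4 * (al * al))%R.
  have -> : (t ^+ 2 = \sum_(j < d) (t * tnth v j) ^+ 2)%R.
    by under eq_bigr do rewrite exprMn; rewrite -mulr_sumr v2 mulr1.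
  apply: (@le_trans _ _ (\sum_(j < d) (
     2 * (e j - (\sum_(i < n) nth 0 (lin 1 (-1) y c) (i * d + j)) / n%:R) ^+ 2 +
     2 * (e j - (\sum_(i < n) nth 0 y (i * d + j)) / n%:R) ^+ 2)))%R.
    apply: ler_sum => j _; rewrite -ct.
    have -> : (\sum_(i < n) nth 0 (lin 1 (-1) y c) (i * d + j) =
       \sum_(i < n) nth 0 y (i * d + j) - \sum_(i < n) nth 0 c (i * d + j))%R.
      rewrite -sumrB; apply: eq_bigr => i _.
      by rewrite nth_lin// mul1r mulN1r.
    by rewrite mulrBl; exact: key.
  rewrite big_split /= -!mulr_sumr.
  have -> : (4 * (al * al) = 2 * (al * al) + 2 * (al * al))%R by ring.
  by apply: lerD; apply: ler_wpM2l.
by nra.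
Qed.

Lemma base_planted p k n d (eta al s : R) (v : vect R d) (bs : n.-tuple bool) :
  hwithin R p k -> (0 < al)%R -> (0 < eta)%R -> (1 <= eta * n%:R)%R ->
  (forall mu : vect R d, (enorm mu <= 21 * al)%R ->
     robustly_estimates p k n eta al mu) ->
  enorm v = 1%R -> good eta n (count id bs) ->
  (0 <= s)%R -> (20 < s * scaleC)%R -> (s * scaleC <= 21)%R ->
  (2 / 3)%:E <= Eg [seq s * m | m <- labelled eta (scaleC * (al / eta)) v bs]%R
    (acc (base p) (k + 7 + 5) n d eta (scaleC * (al / eta))).
Proof.
move=> Hp al0 eta0 etan rob v1 gd s0 s20 s21.
set delta := (scaleC * (al / eta))%R.
have etadelta : (eta * delta = scaleC * al)%R by rewrite /delta; field; rewrite gt_eqF.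
pose mu := vscale (- (s * (eta * delta)))%R v.
have mu21 : (enorm mu <= 21 * al)%R.
  rewrite enorm_vscale v1 mulr1 normrN etadelta mulrA ger0_norm.
    by rewrite ler_wpM2r// ltW.
  by rewrite mulr_ge0//; [apply: le_trans (ltW s20)|exact: ltW].
pose S : samples R n d :=
  [tuple vscale (if tnth bs i then s * delta else 0) v | i < n]%R.
have flatS : flat S = flatten [seq val (vscale (if c then s * delta else 0) v) | c <- bs]%R.
  rewrite /flat; congr flatten; rewrite /S /= -map_comp.
  rewrite -[in RHS](map_tnth_enum bs) -map_comp.
  exact: eq_map.
(* Only labelled samples move, and a good count stays within the budget. *)
have ham X : ((hamming X (shift S X))%:R <= eta * n%:R)%R.
  have /andP[_ le1] := gd; rewrite (mulrC eta); apply: le_trans le1.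
  rewrite -count_sum -natr_sum ler_nat /hamming -sum1_card big_mkcond /=.
  apply: leq_sum => i _; rewrite inE !tnth_mktuple.
  case: (tnth bs i); first by case: ifP.
  rewrite (_ : _ != _ = false)//; apply/negbTE; rewrite negbK; apply/eqP.
  by apply: eq_from_tnth => j; rewrite !tnth_mktuple mul0r addr0.
have := robust_Eg al0 (rob mu mu21) ham.
have -> : lin 1 1 (flatten (nseq n (val mu))) (flat S) =
    [seq s * m | m <- labelled eta delta v bs]%R.
  by rewrite flatS -labelled_shift size_tuple.
move/le_trans; apply.
have szm : size [seq s * m | m <- labelled eta delta v bs]%R = (n * d)%N.
  by rewrite size_map size_labelled size_tuple.
apply: le_Eg.
- exact: mseq_near_shift.
- exact: mseq_acc.
- exact: near_shift_ge0.
- exact: acc_ge0.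
move=> y; rewrite szm => sy; rewrite acc_base// alphaR_scaleC ?gt_eqF//.
have m1 := mmem_far n d al y false.
have m2 := mmem_far n d al (lin 1 (-1) y (flat S)) true.
apply: le_V => // m.
rewrite lee_fin ler_nat.
have n0 : (0 < n%:R :> R)%R.
  by rewrite ltr0n lt0n; apply/negP => /eqP n0; move: etan; rewrite n0 mulr0 ler10.
pose t := ((count id bs)%:R * (s * delta) / n%:R)%R.
(* The count is at least eta n / 10 and s C > 20, so t = count s C alpha / (eta n) exceeds 2
   alpha. *)
have tal : (2 * al < t)%R.
  have /andP[ge1 _] := gd.
  rewrite /t ltr_pdivlMr//.
  have -> : (delta = scaleC * al / eta)%R by rewrite /delta mulrA.
  rewrite -(ltr_pM2r eta0).
  have -> : ((count id bs)%:R * (s * (scaleC * al / eta)) * eta =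
     (count id bs)%:R * (s * scaleC) * al)%R by field; rewrite gt_eqF.
  have -> : (2 * al * n%:R * eta = 2 * (n%:R * eta) * al)%R by ring.
  rewrite ltr_pM2r//; move: ge1 etan; rewrite (mulrC eta).
  move: (_%:R * eta)%R ((count id bs)%:R)%R => x w; nra.
have E := @far_shift n d al t v y (flat S) (m.2 2%N) _ al0 tal v1 _.
case: (boolP (far n d al (lin 1 (-1) y (flat S)) (m.2 2%N))) => // nf.
rewrite E// ?size_flat// => j.
rewrite /t -count_sum mulrAC; congr (_ / _)%R.
rewrite -mulrA mulr_suml; apply: eq_bigr => i _.
rewrite nth_flat !tnth_mktuple; case: (tnth bs i); rewrite ?mul1r//.
by rewrite !mul0r.
Qed.

(** Under the zero shift clean and corrupted data coincide, so acceptance is the complement of a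
    success of the estimator. *)
Lemma base_null p k n d (eta al : R) :
  hwithin R p k -> (0 < al)%R -> (0 < eta)%R ->
  (forall mu : vect R d, (enorm mu <= 21 * al)%R ->
     robustly_estimates p k n eta al mu) ->
  Eg (nseq (n * d) 0%R)
    (acc (base p) (k + 7 + 5) n d eta (scaleC * (al / eta))) <= (1 / 3)%:E.
Proof.
move=> Hp al0 eta0 rob.
pose mu : vect R d := [tuple 0%R | _ < d].
pose S : samples R n d := nseq_tuple n mu.
have zE : flatten (nseq n (val mu)) = nseq (n * d) 0%R.
  apply: (@eq_from_nth _ 0%R) => [|i].
    have := size_flat (nseq_tuple n mu); rewrite /flat /= map_nseq => ->.
    by rewrite size_nseq.
  have /all_nthP H : all (pred1 0%R) (flatten (nseq n (val mu))).
    apply/allP => x /flattenP[z]; rewrite mem_nseq => /andP[_ /eqP ->].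
    by move=> /tnthP[j ->]; rewrite tnth_mktuple /= eqxx.
  by move=> /(H 0%R)/eqP ->; rewrite nth_nseq if_same.
have SE : flat S = nseq (n * d) 0%R by rewrite -zE /flat /= map_nseq.
have linE : lin 1 1 (nseq (n * d) 0%R) (nseq (n * d) 0%R) = nseq (n * d) 0%R :> seq R.
  by elim: (n * d)%N => //= q; rewrite /lin/= !mul1r addr0 => ->.
have mu0 : (enorm mu <= 21 * al)%R.
  rewrite /enorm big1 ?sqrtr0; first by rewrite mulr_ge0// ltW.
  by move=> j _; rewrite tnth_mktuple expr0n.
have sh X : shift S X = X.
  apply: eq_from_tnth => i; apply: eq_from_tnth => j.
  by rewrite !tnth_mktuple (tnth_nth mu S) nth_nseq ltn_ord tnth_mktuple addr0.
have ham X : ((hamming X (shift S X))%:R <= eta * n%:R)%R.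
  rewrite sh /hamming (_ : [set i | _]%SET = finset.set0) ?cards0.
    by rewrite mulr_ge0// ltW.
  by apply/setP => i; rewrite !inE eqxx.
have := robust_Eg al0 (rob mu mu0) ham; rewrite zE SE linE => near.
set f := acc _ _ _ _ _ _.
have mf : mseq f by exact: mseq_acc.
have f0 z : 0 <= f z by exact: acc_ge0.
have : Eg (nseq (n * d) 0%R) f +
    Eg (nseq (n * d) 0%R) (near_shift p k n d eta al (nseq (n * d) 0%R)) = 1.
  rewrite -EgD//; last 2 first.
  - exact: mseq_near_shift.
  - exact: near_shift_ge0.
  rewrite -[RHS](Eg_cst (nseq (n * d) 0%R)); apply: eq_Eg => z.
  rewrite size_nseq => sz; rewrite /f acc_base// alphaR_scaleC ?gt_eqF//.
  rewrite -[RHS](@far_near R p n d eta al z (time_bound k n d)); congr (_ + _).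
  rewrite /near_shift; congr (V _ _ _ _); apply/funext => m.
  rewrite (_ : lin 1 (-1) z _ = z)//.
  by rewrite -[in RHS](@linK R z (nseq (n * d) 0%R)) ?size_nseq//;
    elim: z (n * d)%N sz {m} => [|x z ih] [|q] //= [sz]; rewrite /lin /= !mul1r !mulr0 !addr0; congr (_ :: _); exact: ih.
move: near (Eg_ge0 (nseq (n * d) 0%R) f0); move: (Eg _ f) (Eg _ _) => [x| |] [y| |]//.
by rewrite !lee_fin => ? ? /= [] ?; lra.
Qed.

End reduction.

(** * From acceptance bounds to the distinguishing advantage *)

Section conclusion.
Context (R : realType).
Local Open Scope ereal_scope.

Lemma measurable_sphere d : measurable [set v : vect R d | enorm v = 1%R].
Proof.
have mS : measurable_fun setT
    (fun v : vect R d => (\sum_(i < d) tnth v i ^+ 2)%R : R).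
  apply: measurable_sum => i; apply: measurable_funX.
  exact: measurable_tnth.
have := mS measurableT _ (measurable_set1 (1%R : R)); rewrite setTI.
congr measurable; apply/seteqP; split=> v /=; rewrite /enorm.
  by move=> ->; rewrite sqrtr1.
move=> v1; have S0 : (0 <= \sum_(i < d) tnth v i ^+ 2)%R.
  by apply: sumr_ge0 => i _; exact: sqr_ge0.
by rewrite -(sqr_sqrtr S0) v1 expr1n.
Qed.

(** The simple function equal to q on S and 0 elsewhere lies below f, and the integral is a supremum
    over such functions; in this way the acceptance probability as a function of v does not have to
    be proved measurable. *)
Lemma integral_ge_on dsp (T : measurableType dsp) (P : probability T R)
    (S : set T) (f : T -> \bar R) (q : R) : (0 <= q)%R ->
  measurable S -> P S = 1 -> (forall x, 0 <= f x) ->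
  (forall x, S x -> q%:E <= f x) -> q%:E <= \int[P]_x f x.
Proof.
move=> q0 mS PS f0 fq; rewrite ge0_integralTE//.
pose h : {nnsfun T >-> R} := scale_nnsfun (indic_nnsfun R mS) q0.
apply: ereal_sup_ubound; exists h => [x|].
  rewrite /h /= /mindic indicE.
  case: (boolP (x \in S)) => [/set_mem/fq|_]; first by rewrite mulr1.
  by rewrite mulr0.
rewrite -integralT_nnsfun.
transitivity (\int[P]_x (q%:E * (\1_S x)%:E)); first by apply: eq_integral.
have mI : measurable_fun setT (fun x => (\1_S x)%:E : \bar R).
  by apply/measurable_EFinP; exact: measurable_indic.
have I0 x : setT x -> 0 <= (\1_S x)%:E :> \bar R by rewrite lee_fin.
rewrite (ge0_integralZl_EFin _ measurableT I0 mI q0) integral_indic// setIT.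
by rewrite -[RHS]mule1; congr (_ * _); exact: PS.
Qed.

Lemma null_acceptE p k n d (eta delta : R) :
  null_accept p k n d eta delta =
  Eg (nseq (n * d) 0%R) (acc p k n d eta delta).
Proof.
rewrite /null_accept prod_accept integral_iid_gauss; last 2 first.
- exact: mseq_acc.
- exact: acc_ge0.
congr Eg; set mu := (X in val X).
have sE : size (flatten (nseq n (val mu))) = (n * d)%N.
  by have := size_flat (nseq_tuple n mu); rewrite /flat /= map_nseq => ->.
apply: (@eq_from_nth _ 0%R) => [|i]; first by rewrite sE size_nseq.
have /all_nthP H : all (pred1 0%R) (flatten (nseq n (val mu))).
  apply/allP => x /flattenP[z]; rewrite mem_nseq => /andP[_ /eqP ->].
  by move=> /tnthP[j ->]; rewrite tnth_mktuple /= eqxx.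
by move=> /(H 0%R)/eqP ->; rewrite nth_nseq if_same.
Qed.

(** For each unit vector v the planted acceptance is an average over labels; dropping the bad labels
    leaves q1 times the probability of a good count, which [good_lower] bounds. *)
Lemma distinguishesP p k n d (eta delta c q0 q1 : R) :
  (0 <= eta <= 1 / 3)%R -> (1 <= eta * n%:R)%R ->
  (0 <= q1)%R ->
  Eg (nseq (n * d) 0%R) (acc p k n d eta delta) <= q0%:E ->
  (forall (v : vect R d) (bs : n.-tuple bool), enorm v = 1%R ->
     good eta n (count id bs) ->
     q1%:E <= Eg (labelled eta delta v bs) (acc p k n d eta delta)) ->
  (c + q0 <= (1 / 2) ^+ 30 * q1)%R ->
  distinguishes p k n d eta delta c.
Proof.
move=> eta3 etan q10 null planted cq sigma [s1 _].
rewrite null_acceptE; apply: (@le_trans _ _ (c + q0)%:E).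
  by rewrite EFinD leeD2l.
apply: (@le_trans _ _ ((1 / 2) ^+ 30 * q1)%:E); first by rewrite lee_fin.
have eta1 : (0 <= eta <= 1)%R.
  by case/andP: eta3 => -> /= e3; apply: (le_trans e3); lra.
apply: (integral_ge_on (S := [set v : vect R d | enorm v = 1%R])) => //.
- by rewrite mulr_ge0// exprn_ge0//.
- exact: measurable_sphere.
move=> v v1.
rewrite prod_accept integral_iid_mixture//; last 2 first.
- exact: mseq_acc.
- exact: acc_ge0.
(* The zero terms fit the three-term linearity [ebin_lin]. *)
apply: (@le_trans _ _ (Bin eta n (fun b => (q1 * (good eta n (count id b))%:R +
    0 * 0 + 0 * 0)%:E))%R).
  rewrite (Bin_ebin eta n (fun k => q1 * (good eta n k)%:R + 0 * 0 + 0 * 0)%R).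
  rewrite (ebin_lin eta n q1 0 0 _ (fun=> 0%R) (fun=> 0%R)) !mul0r !addr0 lee_fin.
  by rewrite mulrC ler_wpM2l// good_lower.
apply: le_Bin => // b sb; rewrite !mul0r !addr0.
case: (boolP (good eta n (count id b))) => gd; last first.
  by rewrite mulr0; apply: Eg_ge0 => z; exact: acc_ge0.
rewrite mulr1.
have sb' : size b == n by rewrite sb.
exact: (planted v (Tuple sb') v1 gd).
Qed.

End conclusion.

(** * Numerical constants *)

Section constants.
Context (R : realType).

Lemma scaleC_gt0 : 0 < scaleC R.
Proof.
have h (t : R) : 0 < t -> 0 < t / (120%:R / 169%:R).
  by move=> t0; rewrite divr_gt0// divr_gt0.
by rewrite /scaleC /=; do 5 apply/h; rewrite ltr0n.
Qed.

Lemma scaleC_sinR : sinR R ^+ 5 * scaleC R = 21.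
Proof.
have s0 : sinR R != 0 by rewrite gt_eqF// sinR_gt0.
rewrite /scaleC /= -/(sinR R).
by field; rewrite ?s0.
Qed.

(** Since cos = 119/120 sin, the value is 21 (119/120)^5, about 20.14. *)
Lemma scaleC_cosR : 20 < cosR R ^+ 5 * scaleC R.
Proof.
have -> : cosR R = 119 / 120 * sinR R by rewrite /cosR /sinR; field.
by rewrite exprMn -mulrA scaleC_sinR !exprS expr0; lra.
Qed.

Lemma advantage : 3 * (1 / 3) ^+ 32 + (1 / 3) ^+ (2 ^ 5) =
  (1 / 2) ^+ 30 * (2 / 3) ^+ (2 ^ 5) :> R.
Proof.
rewrite (_ : 2 ^ 5 = 32)%N//.
have -> : (2 / 3 : R) ^+ 32 = (1 / 3) ^+ 32 * 2 ^+ 32.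
  by rewrite -exprMn; congr (_ ^+ 32); field.
have -> : (1 / 2 : R) ^+ 30 * ((1 / 3) ^+ 32 * 2 ^+ 32) =
    ((1 / 2) * 2) ^+ 30 * 2 ^+ 2 * (1 / 3) ^+ 32.
  by rewrite (_ : 32 = 30 + 2)%N// [2 ^+ (30 + 2)]exprD exprMn; ring.
rewrite (_ : 1 / 2 * 2 = 1 :> R); last by field.
by rewrite expr1n; ring.
Qed.

End constants.

Theorem theorem5p12 (R : realType) :
  exists2 C : R, 0 < C &
  forall (n : nat -> nat) (eta alpha : nat -> R) (A : cmd) (k : nat),
    (forall d, 0 <= eta d < 1 / 3) ->
    (forall d, 0 < alpha d) ->
    ((fun d => (n d)%:R : R^o) =o_\oo
      (fun d => d%:R * eta d ^+ 2 / alpha d ^+ 4 : R^o)) ->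
    (\forall d \near \oo, 1 <= eta d * (n d)%:R) ->
    runs_within R A k ->
    (\forall d \near \oo, forall mu : vect R d, enorm mu <= 21 * alpha d ->
      robustly_estimates A k (n d) (eta d) (alpha d) mu) ->
  exists (B : cmd) (l : nat), runs_within R B l /\
    exists2 c : R, 0 < c &
      \forall d \near \oo,
        distinguishes B l (n d) d (eta d) (C * (alpha d / eta d)) c.
Proof.
exists (scaleC R); first exact: scaleC_gt0.
move=> n eta alpha A k eta3 al0 _ near_eta runsA near_rob.
have HA : hwithin R A k by apply/hwithin_runs.
have HB := hwithin_base HA.
exists (stages 5 (base A)), (stages_time 5 (k + 7 + 5)); split.
  by apply/hwithin_runs; exact: hwithin_stages.
(* The planted bound 4 times 3^-32 less the null bound 3^-32. *)
exists (3 * (1 / 3) ^+ 32); first by rewrite mulr_gt0// exprn_gt0.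
apply: filterS2 near_eta near_rob => d etan rob.
have /andP[eta0 eta13] := eta3 d.
have eta_gt0 : 0 < eta d.
  rewrite lt0r eta0 andbT; apply/eqP => e0.
  by move: etan; rewrite e0 mul0r ler10.
have q13 : 0 <= 1 / 3 :> R by [].
have q23 : 0 <= 2 / 3 :> R by [].
apply: (@distinguishesP R _ _ _ _ _ _ _
  ((1 / 3) ^+ (2 ^ 5)) ((2 / 3) ^+ (2 ^ 5))).
- by rewrite eta0 ltW.
- exact: etan.
- exact: exprn_ge0.
- exact: (acc_stages_le 5 HB q13 (base_null HA (al0 d) eta_gt0 rob)).
- move=> v bs v1 gd.
  pose delta := scaleC R * (alpha d / eta d).
  have szb : size (labelled (eta d) delta v bs) = (n d * d)%N
    by rewrite size_labelled size_tuple.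
  (* On these scales the clean means have norm above 20 alpha and at most 21 alpha. *)
  have base_ge s : cosR R ^+ 5 <= s <= sinR R ^+ 5 ->
      ((2 / 3)%:E <= Eg [seq s * m | m <- labelled (eta d) delta v bs]%R
        (acc (base A) (k + 7 + 5) (n d) d (eta d) delta))%E.
    move=> /andP[s1 s2]; apply: base_planted => //.
    + by apply: le_trans s1; rewrite exprn_ge0// ltW// cosR_gt0.
    + by apply: lt_le_trans (scaleC_cosR R) _; rewrite ler_pM2r// scaleC_gt0.
    + by rewrite -(scaleC_sinR R) ler_pM2r// scaleC_gt0.
  (* The planted data themselves have scale 1, the starting point of the five stages. *)
  have := acc_stages_ge (r := 5) HB q23 szb base_ge ler01.
  rewrite !mulr1 => /(_ (lexx _) (lexx _)).
  by rewrite (eq_map (fun m : R => mul1r m)) map_id.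
- by rewrite advantage.
Qed.
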